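(* Let $\mathcal{E}$ be an exponential family of dimension $n$ defined over a finite set $\Omega=\{x_1,\dots,x_m\}$, and let $\Phi:\mathbb{T}^n\times N\to N$ be a Kähler toric manifold which is a regular torification of $\mathcal{E}$. Let $K:N\to\overline{\mathcal{E}}$ be the natural extension of some compatible projection. Assume that $\mathcal{A}_{\mathcal{E}}$ separates the points of $\Omega$ (for all distinct $x,y\in\Omega$ there is $X\in\mathcal{A}_{\mathcal{E}}$ with $X(x)\neq X(y)$). Given $p\in N$, the following conditions are equivalent: (a) $p$ is a fixed point for the torus action $\Phi$. (b) $K(p)=\delta_x$ for some $x\in\Omega$, where $\delta_x(y)=1$ if $x=y$ and $0$ otherwise.
   Context: Kähler toric manifolds. $\mathbb{T}^n=\mathbb{R}^n/\mathbb{Z}^n$; its Lie algebra is identified with $\mathbb{R}^n$ via the derivative at $0$ of the quotient map, and $\mathbb{R}^n$ with its dual via the Euclidean product $\langle\,,\,\rangle$. For an action $\Phi:\mathbb{T}^n\times N\to N$ write $\Phi_a(p)=\Phi(a,p)$ and $\xi_N(p)=\frac{d}{dt}\big|_0\Phi([t\xi],p)$ for $\xi\in\mathbb{R}^n$. A Kähler toric manifold is a connected compact Kähler manifold $N$ of complex dimension $n$ (metric $g$, complex structure $I$, Kähler form $\omega=g(I\cdot,\cdot)$) with an effective action $\Phi$ of $\mathbb{T}^n$ by holomorphic isometries and a momentum map $\mathbf{J}:N\to\mathbb{R}^n$, i.e. a smooth $\mathbb{T}^n$-invariant map with $\omega(\xi_N,\cdot)=d\mathbf{J}^\xi$ for all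 $\xi$, where $\mathbf{J}^\xi(p)=\langle\mathbf{J}(p),\xi\rangle$. $N^\circ$ is the (open, dense, connected) set of points where $\Phi$ is free. Exponential family. $\Omega$ carries the counting measure. $\mathcal{E}$ is the set of probability functions $p_\theta(x)=\exp\big(C(x)+\sum_{k=1}^n\theta_kF_k(x)-\psi(\theta)\big)$, $\theta\in\mathbb{R}^n$, where $C,F_1,\dots,F_n:\Omega\to\mathbb{R}$, $\psi:\mathbb{R}^n\to\mathbb{R}$, and $1,F_1,\dots,F_n$ are linearly independent; $\theta$ is a global chart of $\mathcal{E}$. $\mathbb{E}_p(X)=\sum_{x\in\Omega}X(x)p(x)$. $\mathcal{E}$ carries the Fisher metric $(h_F)_{ij}(\theta)=\mathbb{E}_{p_\theta}(\partial_i\ln p_\theta\,\partial_j\ln p_\theta)$ and the exponential connection $\nabla^{(e)}$, the flat connection for which $\theta_1,\dots,\theta_n$ are affine coordinates. $\mathcal{A}_{\mathcal{E}}$ is the real vector space of functions on $\Omega$ spanned by $F_1,\dots,F_n,1$. Torification. With coordinates $(\theta,\dot\theta)$ on $T\mathcal{E}$ (for the tangent vector $\sum_k\dot\theta_k\partial/\partial\theta_k$ at $p_\theta$), $T\mathcal{E}$ is a Kähler manifold with holomorphic coordinates $z_k=\theta_k+i\dot\theta_k$ and metric given by the block-diagonal matrix $\mathrm{diag}(h_F(\theta),h_F(\theta))$. A parallel lattice $L\subset T\mathcal{E}$ is the set of all integer combinations $\sum k_iY_i(p)$, $p\in\mathcal{E}$, of a frame $Y=(Y_1,\dots,Y_n)$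 of $\nabla^{(e)}$-parallel vector fields on $\mathcal{E}$ (a generator of $L$). $\Gamma(L)\cong\mathbb{Z}^n$ is the group of maps $u\mapsto u+\sum k_iY_i$ of $T\mathcal{E}$; $\mathcal{E}_L=T\mathcal{E}/\Gamma(L)$ with its induced Kähler structure, $q_L:T\mathcal{E}\to\mathcal{E}_L$ is the quotient map, $\pi_L:\mathcal{E}_L\to\mathcal{E}$ the induced projection, and $\mathbb{T}^n$ acts on $\mathcal{E}_L$ by $\Phi_Y([t],q_L(u))=q_L(u+\sum t_iY_i)$. $(N,\Phi)$ is a torification of $\mathcal{E}$ if there are a parallel lattice $L$, a generator $Y$ and a holomorphic isometric diffeomorphism $G:\mathcal{E}_L\to N^\circ$ with $G\circ(\Phi_Y)_a=\Phi_a\circ G$ for all $a\in\mathbb{T}^n$. It is regular if $N$ is connected, simply connected, complete and has real-analytic Kähler metric. A compatible projection is a map $\kappa=\pi_L\circ G^{-1}:N^\circ\to\mathcal{E}$ for some such triple $(L,Y,G)$. Natural extension. $\mathcal{P}_m$ is the set of all probability functions on $\Omega$, with the topology of pointwise convergence, and $\overline{\mathcal{E}}$ is the closure of $\mathcal{E}$ in $\mathcal{P}_m$. Each compatible projection $\kappa$ has a unique continuous extension $K:N\to\overline{\mathcal{E}}$, called its natural extension. *)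

(* Defs.v *)
From HB Require Import structures.
From mathcomp Require Import all_boot all_order all_algebra.
From mathcomp Require Import generic_quotient ring_quotient.
From mathcomp Require Import all_classical all_reals all_analysis.
From mathcomp Require Import ring.

Set Implicit Arguments.
Unset Strict Implicit.
Unset Printing Implicit Defensive.
Import Order.TTheory GRing.Theory Num.Theory.
Import numFieldNormedType.Exports.
Local Open Scope classical_set_scope.
Local Open Scope ring_scope.
Local Open Scope quotient_scope.

(* Only meaningful for U open; the values of f outside U are then irrelevant. *)
Fixpoint Ck_on (R : realType) (V W : normedModType R) (k : nat) (U : set V)
    (f : V -> W) : Prop :=
  match k with
  | 0 => forall x, U x -> {for x, continuous f}
  | k'.+1 => [/\ forall x, U x -> {for x, continuous f},
                 forall x v, U x -> derivable f x v
               & forall v, Ck_on k' U ('D_v f)]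
  end.

Definition smooth_on (R : realType) (V W : normedModType R) (U : set V)
    (f : V -> W) : Prop :=
  forall k, Ck_on k U f.

(* Near each point f is the sum of an absolutely convergent power series in d
   variables; partial sums are taken over the boxes {0, ..., N-1}^d. *)
Definition analytic_on (R : realType) (d : nat) (U : set 'rV[R]_d)
    (f : 'rV[R]_d -> R) : Prop :=
  forall a, U a -> exists (r : R) (c : ('I_d -> nat) -> R), 0 < r /\
    let term (h : 'rV[R]_d) (N : nat) (al : {ffun 'I_d -> 'I_N}) : R :=
      c (fun i => val (al i)) * \prod_(i < d) h 0 i ^+ val (al i) in
    forall h : 'rV[R]_d, (forall i, `|h 0 i| < r) ->
      (exists M : R, forall N : nat,
         \sum_(al : {ffun 'I_d -> 'I_N}) `|term h N al| <= M) /\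
      ((fun N : nat => \sum_(al : {ffun 'I_d -> 'I_N}) term h N al) @ \oo
         --> f (a + h)).

(* C^n is 'rV[R]_(n + n): the left block holds the real parts and the right
   block the imaginary parts of the complex coordinates. *)
Definition mulI (R : realType) (n : nat) (v : 'rV[R]_(n + n))
    : 'rV[R]_(n + n) :=
  row_mx (- rsubmx v) (lsubmx v).

Definition holomorphic_on (R : realType) (n : nat) (U : set 'rV[R]_(n + n))
    (f : 'rV[R]_(n + n) -> 'rV[R]_(n + n)) : Prop :=
  smooth_on U f /\ forall x v, U x -> 'D_(mulI v) f x = mulI ('D_v f x).

(* A topological space with a family of complex charts [kmap i], defined on
   [kdom i] with inverse [kinv i], and for each chart the Gram matrix [kmet i]
   of a metric in the real coordinates of that chart. The functions are total,
   with irrelevant values outside of their domains. The axioms are in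
   [is_kahler]. *)
Record kahlerData (R : realType) (n : nat) := KahlerData {
  kcar :> topologicalType;
  kidx : Type;
  kdom : kidx -> set kcar;
  kmap : kidx -> kcar -> 'rV[R]_(n + n);
  kinv : kidx -> 'rV[R]_(n + n) -> kcar;
  kmet : kidx -> 'rV[R]_(n + n) -> 'M[R]_(n + n)
}.
Arguments kidx {R n} k.
Arguments kdom {R n k}.
Arguments kmap {R n k}.
Arguments kinv {R n k}.
Arguments kmet {R n k}.

Definition kimg (R : realType) (n : nat) (M : kahlerData R n) (i : kidx M)
    : set 'rV[R]_(n + n) :=
  kmap i @` kdom i.

Definition metric (R : realType) (n : nat) (M : kahlerData R n) (i : kidx M)
    (x u v : 'rV[R]_(n + n)) : R :=
  (u *m kmet i x *m v^T) 0 0.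

Definition kform (R : realType) (n : nat) (M : kahlerData R n) (i : kidx M)
    (x u v : 'rV[R]_(n + n)) : R :=
  metric i x (mulI u) v.

Definition local_rep (R : realType) (n : nat) (M N : kahlerData R n)
    (f : M -> N) (i : kidx M) (j : kidx N)
    : 'rV[R]_(n + n) -> 'rV[R]_(n + n) :=
  fun x => kmap j (f (kinv i x)).

Definition is_complex_manifold (R : realType) (n : nat) (M : kahlerData R n)
    : Prop :=
  [/\ hausdorff_space M /\ @second_countable M,
      forall p : M, exists i, kdom i p,
      forall i : kidx M, open (kdom i) /\ open (kimg i),
      forall i : kidx M,
        [/\ {in kdom i, cancel (kmap i) (kinv i)},
            forall p, kdom i p -> {for p, continuous (kmap i)}
          & forall x, kimg i x -> {for x, continuous (kinv i)}]
    & forall i j : kidx M,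
        holomorphic_on (kmap i @` (kdom i `&` kdom j)) (local_rep id i j)].

Definition is_riemannian (R : realType) (n : nat) (M : kahlerData R n)
    : Prop :=
  [/\ forall i : kidx M, smooth_on (kimg i) (kmet i),
      forall (i : kidx M) x u v, kimg i x -> metric i x u v = metric i x v u,
      forall (i : kidx M) x u, kimg i x -> u != 0 -> 0 < metric i x u u
    & forall (i j : kidx M) p u v, kdom i p -> kdom j p ->
        metric i (kmap i p) u v =
        metric j (kmap j p) ('D_u (local_rep id i j) (kmap i p))
                            ('D_v (local_rep id i j) (kmap i p))].

Definition is_kahler (R : realType) (n : nat) (M : kahlerData R n) : Prop :=
  [/\ is_complex_manifold M, is_riemannian M,
      forall (i : kidx M) x u v, kimg i x ->
        metric i x (mulI u) (mulI v) = metric i x u v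
    & forall (i : kidx M) x u v w, kimg i x ->
        'D_u (fun y => kform i y v w) x + 'D_v (fun y => kform i y w u) x
        + 'D_w (fun y => kform i y u v) x = 0].

(* S is meant to be open. *)
Definition smooth_map_on (R : realType) (n : nat) (M N : kahlerData R n)
    (S : set M) (f : M -> N) : Prop :=
  (forall p, S p -> {for p, continuous f}) /\
  forall i j, smooth_on (kmap i @` (kdom i `&` S `&` f @^-1` kdom j))
                        (local_rep f i j).

Definition holomorphic_map (R : realType) (n : nat) (M N : kahlerData R n)
    (f : M -> N) : Prop :=
  smooth_map_on setT f /\
  forall i j p v, kdom i p -> kdom j (f p) ->
    'D_(mulI v) (local_rep f i j) (kmap i p) =
    mulI ('D_v (local_rep f i j) (kmap i p)).

Definition isometric_map (R : realType) (n : nat) (M N : kahlerData R n)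
    (f : M -> N) : Prop :=
  forall i j p u v, kdom i p -> kdom j (f p) ->
    metric j (kmap j (f p)) ('D_u (local_rep f i j) (kmap i p))
                            ('D_v (local_rep f i j) (kmap i p)) =
    metric i (kmap i p) u v.

(* f is a diffeomorphism of M onto the open subset S of N, with inverse finv
   (whose values outside of S are irrelevant). *)
Definition diffeo_onto (R : realType) (n : nat) (M N : kahlerData R n)
    (S : set N) (f : M -> N) (finv : N -> M) : Prop :=
  [/\ range f = S, cancel f finv, smooth_map_on setT f
    & smooth_map_on S finv].

Definition analytic_metric (R : realType) (n : nat) (M : kahlerData R n)
    : Prop :=
  forall (i : kidx M) a b, analytic_on (kimg i) (fun x => kmet i x a b).

Definition simply_connected (R : realType) (T : topologicalType) : Prop :=
  connected [set: T] /\
  forall g : R -> T, {within `[0, 1], continuous g} -> g 0 = g 1 ->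
    exists H : R * R -> T,
      [/\ {within `[0, 1] `*` `[0, 1], continuous H},
          forall t, t \in `[0, 1] -> H (0, t) = g t,
          forall t, t \in `[0, 1] -> H (1, t) = g 0
        & forall s, s \in `[0, 1] -> H (s, 0) = g 0 /\ H (s, 1) = g 0].

Definition C1_curve (R : realType) (n : nat) (M : kahlerData R n)
    (g : R -> M) : Prop :=
  continuous g /\
  forall i : kidx M, Ck_on 1 (g @^-1` kdom i) (kmap i \o g).

Definition curve_length (R : realType) (n : nat) (M : kahlerData R n)
    (g : R -> M) (l : \bar R) : Prop :=
  exists2 speed : R -> R,
    forall t (i : kidx M), kdom i (g t) ->
      speed t = Num.sqrt (metric i (kmap i (g t)) (derive1 (kmap i \o g) t)
                                                  (derive1 (kmap i \o g) t))
  & l = (\int[lebesgue_measure]_(t in `[0%R, 1%R]) (speed t)%:E)%E.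

(* The curves are not required to be regular, so every piecewise C^1 curve can
   be reparametrized into one of these; this is the usual distance. *)
Definition riemannian_dist (R : realType) (n : nat) (M : kahlerData R n)
    (p q : M) : \bar R :=
  ereal_inf [set l | exists g : R -> M,
    [/\ C1_curve g, g 0 = p, g 1 = q & curve_length g l]].

Definition complete_metric (R : realType) (n : nat) (M : kahlerData R n)
    : Prop :=
  forall u : nat -> M,
    (forall e : R, 0 < e -> exists k0 : nat, forall k l : nat,
       (k0 <= k)%N -> (k0 <= l)%N -> (riemannian_dist (u k) (u l) < e%:E)%E) ->
    exists p : M, u @ \oo --> p.

Definition int_vector (R : realType) (n : nat) : 'rV[R]_n -> bool :=
  fun v => [forall i, v 0 i \is a Num.int].

Fact int_vector_zmod_closed (R : realType) (n : nat) :
  zmod_closed (@int_vector R n : {pred 'rV[R]_n}).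
Proof.
split=> [|u v /forallP iu /forallP iv]; apply/forallP => i; rewrite !mxE.
  exact: rpred0.
exact: rpredB.
Qed.
HB.instance Definition _ (R : realType) (n : nat) :=
  GRing.isZmodClosed.Build 'rV[R]_n (@int_vector R n)
    (@int_vector_zmod_closed R n).

Definition Zn (R : realType) (n : nat) : zmodClosed 'rV[R]_n :=
  GRing.ZmodClosed.clone 'rV[R]_n (@int_vector R n) _.

Definition torus (R : realType) (n : nat) : zmodType := Quotient.quot (Zn R n).

Definition torus_pi (R : realType) (n : nat) (t : 'rV[R]_n) : torus R n :=
  \pi_(Quotient.quot (Zn R n)) t.

(* Smoothness on T^n x N is tested on R^n x N, as R^n -> T^n is a surjective
   local diffeomorphism. *)
Definition smooth_action (R : realType) (n : nat) (N : kahlerData R n)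
    (Phi : torus R n -> N -> N) : Prop :=
  [/\ forall p, Phi 0 p = p,
      forall a b p, Phi (a + b) p = Phi a (Phi b p),
      continuous (fun tp : 'rV[R]_n * N => Phi (torus_pi tp.1) tp.2)
    & forall i j : kidx N,
        smooth_on
          [set tx : 'rV[R]_n * 'rV[R]_(n + n) |
             kimg i tx.2 /\ kdom j (Phi (torus_pi tx.1) (kinv i tx.2))]
          (fun tx => kmap j (Phi (torus_pi tx.1) (kinv i tx.2)))].

(* The vector xi_N(p), in the coordinates of the chart i at p. *)
Definition fundamental_vector (R : realType) (n : nat) (N : kahlerData R n)
    (Phi : torus R n -> N -> N) (xi : 'rV[R]_n) (i : kidx N) (p : N)
    : 'rV[R]_(n + n) :=
  derive1 (fun t : R => kmap i (Phi (torus_pi (t *: xi)) p)) 0.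

Definition is_momentum_map (R : realType) (n : nat) (N : kahlerData R n)
    (Phi : torus R n -> N -> N) (J : N -> 'rV[R]_n) : Prop :=
  [/\ forall i : kidx N, smooth_on (kimg i) (J \o kinv i),
      forall a p, J (Phi a p) = J p
    & forall xi (i : kidx N) p v, kdom i p ->
        kform i (kmap i p) (fundamental_vector Phi xi i p) v =
        'D_v (fun x => \sum_(k < n) J (kinv i x) 0 k * xi 0 k) (kmap i p)].

Definition kahler_toric (R : realType) (n : nat) (N : kahlerData R n)
    (Phi : torus R n -> N -> N) : Prop :=
  [/\ is_kahler N, connected [set: N] /\ compact [set: N],
      smooth_action Phi
      /\ (forall a, holomorphic_map (Phi a) /\ isometric_map (Phi a)),
      forall a, (forall p, Phi a p = p) -> a = 0
    & exists J : N -> 'rV[R]_n, is_momentum_map Phi J].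

Definition free_points (R : realType) (n : nat) (N : kahlerData R n)
    (Phi : torus R n -> N -> N) : set N :=
  [set p | forall a, Phi a p = p -> a = 0].

Record expFamily (R : realType) (n : nat) (Omega : finType) := ExpFamily {
  efC : Omega -> R;
  efF : 'I_n -> Omega -> R;
  efpsi : 'rV[R]_n -> R;
  ef_prob : forall theta : 'rV[R]_n,
    \sum_x expR (efC x + \sum_(k < n) theta 0 k * efF k x - efpsi theta) = 1;
  ef_indep : forall (c : R) (a : 'I_n -> R),
    (forall x, c + \sum_(k < n) a k * efF k x = 0) ->
    c = 0 /\ forall k, a k = 0
}.

Section ExponentialFamily.
Context (R : realType) (n : nat) (Omega : finType) (E : expFamily R n Omega).

Definition ef_p (theta : 'rV[R]_n) : {ptws Omega -> R} :=
  fun x => expR (efC E x + \sum_(k < n) theta 0 k * efF E k x - efpsi E theta).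

Definition ef_set : set {ptws Omega -> R} := range ef_p.

Definition ef_A : set (Omega -> R) :=
  [set X | exists (c : R) (a : 'I_n -> R),
     forall x, X x = c + \sum_(k < n) a k * efF E k x].

Definition separates_points (A : set (Omega -> R)) : Prop :=
  forall x y : Omega, x <> y -> exists2 X, A X & X x <> X y.

Definition expectation (p X : Omega -> R) : R := \sum_x X x * p x.

Definition fisher (theta : 'rV[R]_n) : 'M[R]_n :=
  \matrix_(i, j) expectation (ef_p theta)
    (fun x => 'D_(delta_mx 0 i) (fun th => ln (ef_p th x)) theta *
              'D_(delta_mx 0 j) (fun th => ln (ef_p th x)) theta).

Definition prob_functions : set {ptws Omega -> R} :=
  [set p | (forall x, 0 <= p x) /\ \sum_x p x = 1].

Definition ef_closure : set {ptws Omega -> R} :=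
  prob_functions `&` closure ef_set.

(* A vector field on the family is given by its components in the global
   chart theta. As theta is affine for the exponential connection, covariant
   derivatives are derivatives of the components. *)
Definition parallel_field (Y : 'rV[R]_n -> 'rV[R]_n) : Prop :=
  smooth_on setT Y /\ forall theta v, 'D_v Y theta = 0.

Definition parallel_frame (Y : 'I_n -> 'rV[R]_n -> 'rV[R]_n) : Prop :=
  (forall i, parallel_field (Y i)) /\
  forall theta, \matrix_i Y i theta \in unitmx.

(* Points of the tangent bundle are (theta, thetadot) : 'rV[R]_(n + n). *)
Definition translate (Y : 'I_n -> 'rV[R]_n -> 'rV[R]_n) (t : 'rV[R]_n)
    (u : 'rV[R]_(n + n)) : 'rV[R]_(n + n) :=
  row_mx (lsubmx u) (rsubmx u + \sum_(i < n) t 0 i *: Y i (lsubmx u)).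

Definition same_Gamma_orbit (Y : 'I_n -> 'rV[R]_n -> 'rV[R]_n)
    (u v : 'rV[R]_(n + n)) : bool :=
  `[< exists k : 'I_n -> int, v = translate Y (\row_i (k i)%:~R) u >].

Lemma translateD Y s t u :
  translate Y s (translate Y t u) = translate Y (t + s) u.
Proof.
rewrite /translate row_mxKl row_mxKr -addrA -big_split /=.
by congr row_mx; congr (_ + _); apply: eq_bigr => i _; rewrite mxE scalerDl.
Qed.

Lemma translate0 Y u : translate Y 0 u = u.
Proof.
rewrite /translate big1 ?addr0 ?hsubmxK // => i _.
by rewrite mxE scale0r.
Qed.

Lemma same_Gamma_orbit_equiv Y : equiv_class_of (same_Gamma_orbit Y).
Proof.
have sym u v : same_Gamma_orbit Y u v -> same_Gamma_orbit Y v u.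
  move=> /asboolP[k ->]; apply/asboolP; exists (fun i => - k i).
  rewrite translateD -[LHS](translate0 Y); congr translate.
  by apply/rowP => i; rewrite !mxE rmorphN /= subrr.
split=> [u|u v|v u w].
- apply/asboolP; exists (fun=> 0); rewrite -[LHS](translate0 Y).
  by congr translate; apply/rowP => i; rewrite !mxE.
- by apply/idP/idP; exact: sym.
- move=> /asboolP[k ->] /asboolP[l ->]; apply/asboolP.
  exists (fun i => k i + l i); rewrite translateD; congr translate.
  by apply/rowP => i; rewrite !mxE rmorphD.
Qed.

Definition Gamma_rel Y := EquivRelPack (same_Gamma_orbit_equiv Y).

Definition EL_space Y : topologicalType :=
  quotient_topology {eq_quot (Gamma_rel Y)}.

Definition qL Y (u : 'rV[R]_(n + n)) : EL_space Y :=
  \pi_{eq_quot (Gamma_rel Y)} u.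

(* The charts of E_L are the inverses of the restrictions of q_L to the open
   sets on which it is injective: this is the Kähler structure that makes the
   covering q_L a local isomorphism. *)
Definition EL Y : kahlerData R n :=
  @KahlerData R n (EL_space Y)
    {U : set 'rV[R]_(n + n) | open U /\ set_inj U (qL Y)}
    (fun U => qL Y @` sval U)
    (fun U y => xget 0 [set u | sval U u /\ qL Y u = y])
    (fun _ => qL Y)
    (fun _ u => block_mx (fisher (lsubmx u)) 0 0 (fisher (lsubmx u))).

Definition EL_repr Y (y : EL Y) : 'rV[R]_(n + n) :=
  repr (y : {eq_quot (Gamma_rel Y)}).

Definition piL Y (y : EL Y) : {ptws Omega -> R} :=
  ef_p (lsubmx (EL_repr y)).

Definition torus_repr (a : torus R n) : 'rV[R]_n :=
  repr (a : Quotient.quot (Zn R n)).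

Definition PhiY Y (a : torus R n) (y : EL Y) : EL Y :=
  qL Y (translate Y (torus_repr a) (EL_repr y)).

Lemma qL_eqP Y u v : reflect (qL Y u = qL Y v) (same_Gamma_orbit Y u v).
Proof. exact: (iffP (eqmodP (Gamma_rel Y) u v)). Qed.

(* [piL] and [PhiY] do not depend on the chosen representatives. *)
Lemma piLE Y (u : 'rV[R]_(n + n)) : piL (qL Y u : EL Y) = ef_p (lsubmx u).
Proof.
have : qL Y u = qL Y (EL_repr (qL Y u : EL Y)) by rewrite /EL_repr /qL reprK.
move=> /qL_eqP/asboolP[k uk].
by rewrite /piL uk /translate row_mxKl.
Qed.

Lemma PhiYE Y (t : 'rV[R]_n) (u : 'rV[R]_(n + n)) :
  PhiY (torus_pi t) (qL Y u : EL Y) = qL Y (translate Y t u).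
Proof.
have : qL Y u = qL Y (EL_repr (qL Y u : EL Y)) by rewrite /EL_repr /qL reprK.
move=> /qL_eqP/asboolP[k uk].
rewrite /PhiY; set t' := torus_repr (torus_pi t).
have /forallP tt' : int_vector (t' - t).
  have := Quotient.idealrBE (Zn R n) t' t.
  by rewrite /t' /torus_repr /torus_pi reprK eqxx.
apply/esym/qL_eqP/asboolP.
exists (fun i => k i + Num.floor ((t' - t) 0 i)).
clearbody t'.
rewrite uk !translateD; congr translate; apply/rowP => i.
by have := floorK (tt' i); rewrite !mxE rmorphD /= => ->; ring.
Qed.

(* (Y, G) realizes N as a torification of the family, where L is the lattice
   generated by Y; Ginv is the inverse of G. *)
Definition torification_by (N : kahlerData R n) (Phi : torus R n -> N -> N)
    (Y : 'I_n -> 'rV[R]_n -> 'rV[R]_n) (G : EL Y -> N) (Ginv : N -> EL Y)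
    : Prop :=
  [/\ parallel_frame Y, diffeo_onto (free_points Phi) G Ginv,
      holomorphic_map G, isometric_map G
    & forall a y, G (PhiY a y) = Phi a (G y)].

Definition is_torification (N : kahlerData R n) (Phi : torus R n -> N -> N)
    : Prop :=
  exists Y G Ginv, @torification_by N Phi Y G Ginv.

Definition regular_torification (N : kahlerData R n)
    (Phi : torus R n -> N -> N) : Prop :=
  [/\ is_torification Phi, connected [set: N], simply_connected R N,
      complete_metric N & analytic_metric N].

(* Only the values of kappa on [free_points Phi] are relevant. *)
Definition compatible_projection (N : kahlerData R n)
    (Phi : torus R n -> N -> N) (kappa : N -> {ptws Omega -> R}) : Prop :=
  exists Y G Ginv, @torification_by N Phi Y G Ginv /\
    forall p, free_points Phi p -> kappa p = piL (Ginv p).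

Definition natural_extension (N : kahlerData R n)
    (Phi : torus R n -> N -> N) (kappa K : N -> {ptws Omega -> R}) : Prop :=
  [/\ continuous K, forall p, ef_closure (K p)
    & forall p, free_points Phi p -> K p = kappa p].

Definition dirac_fun (x : Omega) : {ptws Omega -> R} :=
  fun y => if x == y then 1 else 0.

End ExponentialFamily.

Arguments dirac_fun R {Omega} x.

(* Main.v *)
Require Import Defs.
From HB Require Import structures.
From mathcomp Require Import all_boot all_order all_algebra.
From mathcomp Require Import generic_quotient ring_quotient.
From mathcomp Require Import all_classical all_reals all_analysis.
From mathcomp Require Import ring lra.

Set Implicit Arguments.
Unset Strict Implicit.
Unset Printing Implicit Defensive.
Import Order.TTheory GRing.Theory Num.Theory.
Import numFieldNormedType.Exports.
Local Open Scope classical_set_scope.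
Local Open Scope ring_scope.

(** On the free points, the isometry with the quotient of the tangent bundle
    gives |xi_N|^2(q) = Var_(K q) <Y xi, F>, the quadratic form of the Fisher
    metric. Free points are dense and both sides are continuous, so the identity
    holds on all of N. If p is fixed, then F is constant on the support of K p,
    and separation of points leaves a single point in that support. If K p is a
    Dirac function, then xi_N vanishes at p, hence along its orbit because K is
    invariant, and p is fixed.

    Density of the free points: a nontrivial closed subgroup of the torus has a
    nontrivial torsion element, there are countably many of these, and the fixed
    points of each of them have empty interior, so Baire's theorem applies. *)

(** * Closed subgroups of R^n containing Z^n *)

Lemma subgroup_natmul (V : zmodType) (H : set V) (h : V) (m : nat) :
  H 0 -> (forall a b, H a -> H b -> H (a - b)) -> H h -> H (h *+ m).
Proof.
move=> H0 HB Hh; elim: m => [|m IH]; first by rewrite mulr0n.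
have -> : h *+ m.+1 = h - (0 - h *+ m) by rewrite sub0r opprK mulrS.
exact: (HB) Hh (HB _ _ H0 IH).
Qed.

Lemma subgroup_intmul (V : zmodType) (H : set V) (h : V) (z : int) :
  H 0 -> (forall a b, H a -> H b -> H (a - b)) -> H h -> H (h *~ z).
Proof.
move=> H0 HB Hh; case: z => m.
  by rewrite -pmulrn; exact: (@subgroup_natmul _ H).
rewrite NegzE mulrNz -sub0r -pmulrn; apply: (HB) => //.
exact: (@subgroup_natmul _ H).
Qed.

(** Euclidean division of x by h: the floor of x / h is the quotient, the bounded term the
    remainder. *)
Lemma floor_div_bound (R : realType) (x h : R) : 0 < h ->
  0 <= x - h *~ Num.floor (x / h) < h.
Proof.
move=> h0; have /andP[lo hi] := floor_itv (x / h).
rewrite ler_pdivlMr // in lo; rewrite ltr_pdivrMr // intrD1 in hi.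
rewrite -mulrzr; apply/andP; split; lra.
Qed.

(** If H has arbitrarily small positive elements, their multiples approximate 1/2, which lies in H
    by closedness. Otherwise H is generated by its least positive element c; then 1 = k c, and k = 1
    would make H consist of integers. *)
Lemma subgroup_real_unit_fraction (R : realType) (H : set R) :
  H 1 -> (forall a b, H a -> H b -> H (a - b)) -> closed (H `&` `[0, 1]) ->
  (exists2 s, H s & s \isn't a Num.int) ->
  exists2 k : nat, (1 < k)%N & H (k%:R^-1).
Proof.
move=> H1 HB Hcl [s Hs sN].
have H0 : H 0 by rewrite -(subrr 1); exact: (HB).
have HZ h z : H h -> H (h *~ z) by exact: (@subgroup_intmul _ H).
have [small|/existsNP[e /not_implyP[e0 noe]]] :=
    pselect (forall e : R, 0 < e -> exists2 h, H h & 0 < h < e).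
  exists 2%N => //; suff [] : (H `&` `[0, 1]) (2%:R^-1 : R) by [].
  apply: Hcl => B /nbhs_ballP[e /= e0 eB].
  have [|h Hh /andP[h0 he]] := small (Num.min e 2^-1).
    by rewrite lt_min e0 /= invr_gt0.
  move: he; rewrite lt_min => /andP[he h2].
  have /andP[lo hi] := floor_div_bound (2^-1) h0.
  exists (h *~ Num.floor (2^-1 / h)); split; first split.
  - exact: HZ.
  - by rewrite /= in_itv /=; apply/andP; split; lra.
  - by apply: eB; rewrite /ball /= ger0_norm; lra.
pose P := [set h | H h /\ 0 < h].
have Pe h : P h -> e <= h.
  move=> [Hh h0]; rewrite leNgt; apply/negP => he.
  by apply: noe; exists h => //; rewrite h0.
have Pinf : has_inf P by split; [exists 1; split | exists e].
have ce : e <= inf P by apply: lb_le_inf; [exists 1; split | exact: Pe].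
have lb h : P h -> inf P <= h by apply: ge_inf; exact: Pinf.2.
(* Otherwise P has two distinct elements below 2 inf P, and their difference is an element of P
   below inf P. *)
have Pc : P (inf P).
  have [d Pd dc] := inf_adherent (lt_le_trans e0 ce) Pinf.
  have [->//|dn] := eqVneq (inf P) d.
  have cd : inf P < d by rewrite lt_neqAle dn lb.
  have [f Pf] := @inf_adherent _ P (d - inf P) ltac:(lra) Pinf.
  rewrite addrC subrK => fd.
  have /lb : P (d - f) by split; [apply: (HB); [exact: Pd.1|exact: Pf.1]|lra].
  have := lb _ Pf; lra.
set c := inf P in ce lb Pc *.
have c0 : 0 < c := Pc.2.
have Hmul h : H h -> exists z : int, h = c *~ z.
  move=> Hh; exists (Num.floor (h / c)).
  have /andP[lo hi] := floor_div_bound h c0.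
  apply/eqP; rewrite -subr_eq0 eq_le lo andbT leNgt; apply/negP => gt0.
  have /lb : P (h - c *~ Num.floor (h / c)).
    by split => //; apply: (HB) => //; exact: HZ Pc.1.
  lra.
have [z z1] := Hmul 1 H1.
have [k zk] : exists k : nat, z = k.
  case: z z1 => k; first by exists k.
  rewrite NegzE mulrNz => z1; exfalso.
  have : 0 <= c *~ k.+1 by rewrite -pmulrn mulrn_wge0 // ltW.
  lra.
move: z1; rewrite zk -pmulrn -mulr_natl => z1.
have k0 : (k%:R : R) != 0 by apply/eqP => k0; move: z1; rewrite k0; lra.
have ck : c = k%:R^-1 by apply: (mulfI k0); rewrite -z1 divff.
exists k; last by rewrite -ck; exact: Pc.1.
case: k {zk} k0 ck {z1} => [|[|k]] // k0 ck; first by rewrite eqxx in k0.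
case/negP: sN; have [m ->] := Hmul s Hs.
by rewrite ck invr1 intr_int.
Qed.

(* Induction on the number k of leading coordinates of h that are not assumed
   to be rational. *)
Lemma closed_subgroup_torsion (R : realType) (n : nat) (H : set 'rV[R]_n) :
  closed H -> (forall a b, H a -> H b -> H (a - b)) ->
  (forall z, int_vector z -> H z) ->
  (forall h (m : nat), H h -> (0 < m)%N -> int_vector (h *+ m) ->
     int_vector h) ->
  forall h, H h -> int_vector h.
Proof.
move=> Hcl HB HZ Htor.
have int0 : int_vector (0 : 'rV[R]_n).
  by apply/forallP => i; rewrite mxE rpred0.
have H0 : H 0 by exact: HZ.
have HM h m : H h -> H (h *+ m) by exact: (@subgroup_natmul _ H).
suff A (k : nat) (h : 'rV[R]_n) (m : nat) : (k <= n)%N -> H h -> (0 < m)%N ->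
    (forall i : 'I_n, (k <= i)%N -> h 0 i *+ m \is a Num.int) -> int_vector h.
  by move=> h Hh; apply: (A n h 1%N) => // i; rewrite leqNgt ltn_ord.
elim: k h m => [|k IH] h m kn Hh m0 hint.
  by apply: (Htor _ m) => //; apply/forallP => i; rewrite mulmxnE; apply: hint.
pose ik := Ordinal kn.
(* The one-dimensional lemma is applied to this subgroup of R. A fraction 1/l in it, with l > 1,
   would come from some g in H with l g integral from index k on; the induction hypothesis makes g
   integral, a contradiction. *)
pose Hk := [set s | exists2 g, H g &
   g 0 ik = s /\ forall i : 'I_n, (k < i)%N -> g 0 i = 0].
have HkB a b : Hk a -> Hk b -> Hk (a - b).
  move=> [g Hg [<- gi]] [f Hf [<- fi]]; exists (g - f); first exact: (HB).
  by split=> [|i ki]; rewrite !mxE // gi // fi // subrr.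
(* Subtracting an integer vector brings the coordinates before k into [0, 1]. In [Hkcl] this
   exhibits the set as a projection of a compact part of H. *)
have trunc g : H g -> exists2 g', H g' & forall i : 'I_n,
    ((i < k)%N -> g' 0 i \in `[0, 1]) /\ ((k <= i)%N -> g' 0 i = g 0 i).
  move=> Hg; pose z : 'rV[R]_n :=
    \row_i (if (i < k)%N then (Num.floor (g 0 i))%:~R else 0).
  exists (g - z).
    apply: (HB) => //; apply: HZ; apply/forallP => i; rewrite !mxE.
    by case: ifP => _; [rewrite intr_int|rewrite rpred0].
  move=> i; rewrite !mxE; case: ltnP => ki; split=> // _; last first.
    by rewrite subr0.
  have /andP[lo hi] := floor_itv (g 0 i); rewrite intrD1 in hi.
  by rewrite in_itv /=; apply/andP; split; lra.
have Hkcl : closed (Hk `&` `[0, 1]).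
  pose C := [set v : 'rV[R]_n | forall i, `[0, 1]%classic (v 0 i)] `&`
    (H `&` \bigcap_(i in [set i : 'I_n | (k < i)%N]) [set v | v 0 i = 0]).
  have -> : Hk `&` `[0, 1] = (fun v : 'rV[R]_n => v 0 ik) @` C.
    apply/seteqP; split=> s.
      move=> [[g Hg [gs gi]] s01].
      have [g' Hg' g'i] := trunc g Hg.
      have g'k (i : 'I_n) : (k < i)%N -> g' 0 i = 0.
        by move=> ki; rewrite (g'i i).2 ?gi // ltnW.
      exists g'; last by rewrite (g'i ik).2 //= leqnn.
      split=> [i /=|]; last by split=> //.
      case: (ltngtP i k) => ik'; first exact: (g'i i).1.
        by rewrite g'k // in_itv /= lexx ler01.
      by have -> : i = ik by [exact: val_inj]; rewrite (g'i ik).2 //= gs.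
    move=> [v [v01 [Hv vi]] <-]; split; last exact: v01.
    by exists v => //; split=> // i /vi.
  apply: compact_closed; first exact: norm_hausdorff.
  apply: continuous_compact.
    by apply: continuous_subspaceT => v; exact: coord_continuous.
  apply: compact_closedI.
    by apply: (@rV_compact R n (fun=> `[0, 1]%classic)) => i; exact: segment_compact.
  apply: closedI => //; apply: closed_bigI => i _.
  apply: (@closed_comp _ _ (fun v : 'rV[R]_n => v 0 i) [set 0]).
    by move=> v _; exact: coord_continuous.
  exact: closed_eq.
have Hk1 : Hk 1.
  exists (delta_mx 0 ik).
    by apply: HZ; apply/forallP => i; rewrite !mxE natr_int.
  split=> [|i ki]; first by rewrite !mxE !eqxx.
  by rewrite !mxE eqxx /=; case: eqP => // iik; rewrite iik /= ltnn in ki.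
have Hkint s : Hk s -> s \is a Num.int.
  move=> Hs; apply/negPn/negP => sN.
  have [|l l1 [g Hg [gl gi]]] :=
    @subgroup_real_unit_fraction R Hk Hk1 HkB Hkcl; first by exists s.
  have l0 : (0 < l)%N by exact: ltnW.
  have lR : (l%:R : R) != 0 by rewrite pnatr_eq0 -lt0n.
  have /forallP/(_ ik) : int_vector g.
    apply: (IH g l) => //; first exact: ltnW.
    move=> i; rewrite leq_eqVlt => /orP[/eqP ki|ki].
      have -> : i = ik by exact: val_inj.
      by rewrite gl -(mulr_natl (l%:R^-1)) divff // rpred1.
    by rewrite gi // mul0rn rpred0.
  rewrite gl => /intrP[z zl].
  have : 0 < (l%:R^-1 : R) < 1.
    by rewrite invr_gt0 ltr0n l0 invf_lt1 ?ltr0n // ltr1n.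
  by rewrite zl ltr0z ltrz1; case: z {zl} => [[|[|z]]|z].
(* Beyond index k the vector m h is integral, so m h - z vanishes there and its coordinate k lies in
   [Hk], hence is an integer. The same m then serves in the induction hypothesis. *)
have [z zh] : exists z : 'rV[R]_n, int_vector z /\
    forall i : 'I_n, (k < i)%N -> z 0 i = h 0 i *+ m.
  exists (\row_i if (k < i)%N then h 0 i *+ m else 0).
  split=> [|i ki]; last by rewrite mxE ki.
  by apply/forallP => i; rewrite mxE; case: ifP => [/hint//|_]; rewrite rpred0.
apply: (IH h m) => // [|i]; first exact: ltnW.
rewrite leq_eqVlt => /orP[/eqP ki|]; last exact: hint.
have -> : i = ik by exact: val_inj.
have : Hk ((h *+ m - z) 0 ik).
  exists (h *+ m - z); first by apply: (HB); [exact: HM|exact/HZ/zh.1].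
  by split=> // j kj; rewrite !mxE zh.2 // mulmxnE subrr.
move=> /Hkint; rewrite !mxE mulmxnE => hz.
by rewrite -[_ *+ _](subrK (z 0 ik)) rpredD //; exact: (forallP zh.1).
Qed.

(** * Calculus *)

(** Baire's theorem is used below in chart coordinates, hence on row vectors as a complete normed
    space. *)
HB.instance Definition _ (R : realType) (m n : nat) :=
  Complete.on 'M[R]_(m, n).

(** Baire's theorem is applied to the complements of the closures of the sets V ∩ F k. A nonempty
    open W inside such a closure would meet V in a nonempty open set contained in F k. *)
Lemma baire_open (R : realType) (U : completeNormedModType R) (V : set U)
    (F : nat -> set U) :
  open V -> V !=set0 ->
  (forall k x, V x -> closure (V `&` F k) x -> F k x) ->
  (forall k W, open W -> W `<=` V `&` F k -> W = set0) ->
  exists2 x, V x & forall k, ~ F k x.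
Proof.
move=> Vo V0 Fcl Fi.
have [|x [Vx Ox]] := @Baire R U (fun k => ~` closure (V `&` F k)) _ V V0 Vo.
  move=> k; split; first exact/closed_openC/closed_closure.
  move=> W [w Ww] Wo; apply: contrapT => WF.
  have WcF : W `<=` closure (V `&` F k).
    by move=> y Wy; apply: contrapT => yF; apply: WF; exists y.
  have [y [[Vy Fy] Wy]] : (V `&` F k) `&` W !=set0.
    by apply: (WcF w) => //; exact: open_nbhs_nbhs.
  have : (W `&` V) y by [].
  rewrite (Fi k (W `&` V)) //; first exact: openI.
  by move=> z [Wz Vz]; split=> //; apply: Fcl => //; exact: WcF.
exists x => // k Fx; apply: (Ox k I).
exact: subset_closure.
Qed.

Section Calculus.
Context (R : realType).

Lemma is_derive_line (V W : normedModType R) (f : V -> W) (a v : V) (t : R) :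
  derivable f (a + t *: v) v ->
  is_derive t 1 (fun s : R => f (a + s *: v)) ('D_v f (a + t *: v)).
Proof.
have E : (fun h : R => h^-1 *: (((fun s : R => f (a + s *: v)) \o shift t) (h *: 1)
           - f (a + t *: v)))
       = (fun h : R => h^-1 *: ((f \o shift (a + t *: v)) (h *: v) - f (a + t *: v))).
  apply/funext => h /=; congr (_ *: (f _ - _)).
  by rewrite [h *: 1]mulr1 scalerDl addrCA addrA.
by move=> fd; split; rewrite /derivable /derive E.
Qed.

Lemma derive_line0 (V W : normedModType R) (f : V -> W) (x v : V) :
  'D_v f x = 'D_(1 : R) (fun h : R => f (h *: v + x)) 0.
Proof.
rewrite /derive; set F := (F in lim (F @ _)); set G := (G in _ = lim (G @ _)).
suff -> : F = G by []; apply/funext => h; rewrite /F /G /=.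
by rewrite scale0r add0r addr0 [h *: 1]mulr1.
Qed.

Lemma is_derive_bigsum (I : Type) (r : seq I) (V W : normedModType R)
    (f : I -> V -> W) (df : I -> W) (x v : V) :
  (forall i, is_derive x v (f i) (df i)) ->
  is_derive x v (fun y => \sum_(i <- r) f i y) (\sum_(i <- r) df i).
Proof.
move=> fd; elim: r => [|i r IH].
  rewrite big_nil; under eq_fun do rewrite big_nil.
  exact: is_derive_cst.
rewrite big_cons; under eq_fun do rewrite big_cons.
exact: is_deriveD.
Qed.

Lemma continuous_bigsum (I : Type) (r : seq I) (T : topologicalType)
    (W : normedModType R) (f : I -> T -> W) (t : T) :
  (forall i, {for t, continuous (f i)}) ->
  {for t, continuous (fun s => \sum_(i <- r) f i s)}.
Proof.
move=> fc; elim: r => [|i r IH].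
  rewrite /prop_for; under eq_fun do rewrite big_nil.
  exact: cst_continuous.
rewrite /prop_for; under eq_fun do rewrite big_cons.
by apply: continuousD; [exact: fc | exact: IH].
Qed.

(** Mean value theorem for s ↦ f (a + s v) between 0 and c; the symmetric range |t| <= |c| treats
    both signs of c at once. *)
Lemma le_increment (V : normedModType R) (f : V -> R) (a v : V) (c M : R) :
  (forall t : R, `|t| <= `|c| ->
     derivable f (a + t *: v) v /\ `|'D_v f (a + t *: v)| <= M) ->
  `|f (a + c *: v) - f a| <= M * `|c|.
Proof.
move=> fd; pose g (s : R) : R := f (a + s *: v).
have gd (t : R) : `|t| <= `|c| -> is_derive t 1 g ('D_v f (a + t *: v)).
  by move=> /fd[+ _]; exact: is_derive_line.
have -> : f a = g 0 by rewrite /g scale0r addr0.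
rewrite -/(g c).
have [c0|c0|->] := ltgtP c 0; last by rewrite subrr !normr0 mulr0.
- have bd (t : R) : t \in `[c, 0] -> `|t| <= `|c|.
    rewrite in_itv /= => /andP[ct t0]; rewrite !ler0_norm //; lra.
  have [||x xc] := @MVT R g (fun t => 'D_v f (a + t *: v)) c 0 c0.
  + by move=> t tc; apply/gd/bd; exact: subset_itv_oo_cc.
  + by apply: derivable_within_continuous => t tc; have [] := gd t (bd t tc).
  rewrite distrC => ->; rewrite normrM sub0r normrN ler_wpM2r //.
  by have [] := fd x (bd x (subset_itv_oo_cc xc)).
- have bd (t : R) : t \in `[0, c] -> `|t| <= `|c|.
    rewrite in_itv /= => /andP[ct t0]; rewrite !ger0_norm //; lra.
  have [||x xc] := @MVT R g (fun t => 'D_v f (a + t *: v)) 0 c c0.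
  + by move=> t tc; apply/gd/bd; exact: subset_itv_oo_cc.
  + by apply: derivable_within_continuous => t tc; have [] := gd t (bd t tc).
  move=> ->; rewrite normrM subr0 ler_wpM2r //.
  by have [] := fd x (bd x (subset_itv_oo_cc xc)).
Qed.

Lemma derive_coord (V : normedModType R) (d : nat) (f : V -> 'rV[R]_d)
    (x v : V) (j : 'I_d) : derivable f x v ->
  is_derive x v (fun y => f y 0 j) ('D_v f x 0 j).
Proof.
move=> fd; split; first by have/derivable_mxP := fd; apply.
by rewrite derive_mx // mxE.
Qed.

Lemma derive0_eq (V : normedModType R) (d : nat) (f : V -> 'rV[R]_d)
    (a v : V) (c : R) :
  (forall t : R, `|t| <= `|c| ->
     derivable f (a + t *: v) v /\ 'D_v f (a + t *: v) = 0) ->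
  f (a + c *: v) = f a.
Proof.
move=> fd; apply/rowP => j; apply/eqP; rewrite -subr_eq0 -normr_le0.
rewrite -[leRHS](mul0r `|c|).
apply: (@le_increment V (fun y => f y 0 j)) => t /fd[ft f0].
have [fjt ->] := derive_coord j ft.
by rewrite f0 mxE normr0.
Qed.

Lemma near_rV (d : nat) (x0 : 'rV[R]_d) (P : set 'rV[R]_d) :
  (\forall x \near x0, P x) ->
  exists2 r : R, 0 < r & forall x : 'rV[R]_d, (forall i, `|x 0 i - x0 0 i| < r) -> P x.
Proof.
move=> /nbhs_ballP[r /= r0 rP]; exists r => // x xr; apply: rP.
split=> // i j; rewrite ord1; have := xr j.
by rewrite /ball /= distrC.
Qed.

Lemma near_dist_lt (T : topologicalType) (h : T -> R) (x : T) (e : R) :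
  {for x, continuous h} -> 0 < e -> nbhs x [set y | `|h y - h x| < e].
Proof.
move=> hc e0; have /cvgrPdist_lt/(_ e e0) := hc.
by apply: filterS => y; rewrite distrC.
Qed.

(* The map f - id has small partial derivatives near x0, hence is a contraction
   for the sum norm. *)
Lemma derive_id_injective (d : nat) (f : 'rV[R]_d -> 'rV[R]_d)
    (df : 'I_d -> 'rV[R]_d -> 'rV[R]_d) (x0 : 'rV[R]_d) :
  (forall l, \forall x \near x0, is_derive x (delta_mx 0 l) f (df l x)) ->
  (forall l, {for x0, continuous (df l)}) ->
  (forall l, df l x0 = delta_mx 0 l) ->
  \forall z \near (x0, x0), f z.1 = f z.2 -> z.1 = z.2.
Proof.
(* This choice gives d e < 1 at the end, d = 0 included. *)
move=> fd fc f1; pose e : R := d.+1%:R^-1.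
have e0 : 0 < e by rewrite invr_gt0 ltr0n.
pose g j (x : 'rV[R]_d) : R := f x 0 j - x 0 j.
pose Q l j := [set x | derivable (g j) x (delta_mx 0 l) /\
    `|'D_(delta_mx 0 l) (g j) x| <= e].
have : \forall x \near x0, forall l j, Q l j x.
  apply: (filter_forall (nbhs_filter x0)) => l.
  apply: (filter_forall (nbhs_filter x0)) => j.
  have ce : nbhs x0 [set x |
      `|df l x 0 j - (delta_mx 0 l : 'rV[R]_d) 0 j| < e].
    have := @near_dist_lt _ (fun x => df l x 0 j) x0 e.
    rewrite f1; apply => //.
    apply: (@continuous_comp _ _ _ (df l) (fun M => M 0 j)).
      exact: fc.
    exact: coord_continuous.
  move: (fd l); move: ce; apply: (@filterS2 _ _ (nbhs_filter x0)) => x fe fx.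
  have xd : derivable (fun y : 'rV[R]_d => y) x (delta_mx 0 l) by exact: derivable_id.
  have [fd' fE] := fx; have dfj := derive_coord j fd'; have dx := derive_coord j xd.
  rewrite derive_id in dx.
  have [gd gE] := is_deriveB dfj dx.
  by split=> //; rewrite gE fE ltW.
move=> /near_rV[r r0 rP].
(* Points within r/4 of [x0] differ by less than r/2 in each coordinate, so the intermediate points
   between them stay within 3r/4 of [x0]. *)
have r4 : 0 < r / 4 by rewrite divr_gt0.
exists (ball x0 (r / 4), ball x0 (r / 4)).
  by split; exact: nbhsx_ballx.
case=> x y [/= [_ xr] [_ yr]] fxy.
have xk k : `|x0 0 k - x 0 k| < r / 4 by exact: xr.
have yk k : `|x0 0 k - y 0 k| < r / 4 by exact: yr.
(* Passing from y to x one coordinate at a time involves only partial derivatives. *)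
pose w (k : nat) : 'rV[R]_d := \row_i (if (i < k)%N then x 0 i else y 0 i).
have step j (k : nat) (kd : (k <= d)%N) : `|g j (w k) - g j y| <=
    \sum_(i < d | (i < k)%N) e * `|x 0 i - y 0 i|.
  elim: k kd => [|k IH] kd.
    have -> : w 0 = y by apply/rowP => i; rewrite mxE.
    by rewrite subrr normr0 big_pred0.
  pose ik := Ordinal kd.
  rewrite (bigD1 ik) //= addrC.
  rewrite (eq_bigl (fun i : 'I_d => (i < k)%N)); last first.
    move=> i /=; rewrite ltnS [in RHS]ltn_neqAle andbC.
    by rewrite -(inj_eq val_inj).
  have -> : w k.+1 = w k + (x 0 ik - y 0 ik) *: delta_mx 0 ik.
    apply/rowP => i; rewrite !mxE eqxx /= ltnS leq_eqVlt -(inj_eq val_inj) /=.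
    case: eqP => [ik'|_] /=; last by rewrite mulr0 addr0.
    have -> : i = ik by exact: val_inj.
    by rewrite ltnn mulr1 addrC subrK.
  rewrite -[X in `|X - _|](subrK (g j (w k))) -addrA addrC.
  apply: (le_trans (ler_normD _ _)); apply: lerD; first exact/IH/ltnW.
  apply: le_increment => t tl; apply: rP => i.
  have xyi : `|t| < r / 2.
    by apply: (le_lt_trans tl); have := xk ik; have := yk ik; rewrite !ltr_norml; lra.
  have wi : `|w k 0 i - x0 0 i| < r / 4 by rewrite mxE distrC; case: ifP.
  rewrite !mxE eqxx /= in wi *.
  have tb : `|t * (i == ik)%:R| < r / 2.
    by case: eqP; rewrite ?mulr1 // mulr0 normr0 divr_gt0.
  by move: wi tb; rewrite !ltr_norml; lra.
pose S := \sum_(i < d) `|x 0 i - y 0 i|.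
have xyS j : `|x 0 j - y 0 j| <= e * S.
  have := step j d (leqnn d).
  have -> : w d = x by apply/rowP => i; rewrite mxE ltn_ord.
  rewrite (eq_bigl xpredT) => [|i]; last by rewrite ltn_ord.
  rewrite -mulr_sumr /g fxy -/S => H; apply: le_trans H.
  have -> : f y 0 j - x 0 j - (f y 0 j - y 0 j) = - (x 0 j - y 0 j) by ring.
  by rewrite normrN.
have S0 : 0 <= S by apply: sumr_ge0.
have : S <= d%:R * (e * S).
  apply: (@le_trans _ _ (\sum_(j < d) e * S)); first exact: ler_sum.
  by rewrite sumr_const card_ord mulr_natl.
move=> SS; have {}S0 : S = 0.
  apply/eqP; rewrite eq_le S0 andbT leNgt; apply/negP => Sp.
  have de : d%:R * e < 1 by rewrite ltr_pdivrMr ?ltr0n // mul1r ltr_nat.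
  suff : d%:R * (e * S) < S by lra.
  by rewrite mulrA gtr_pMl.
apply/rowP => j; apply/eqP; rewrite -subr_eq0 -normr_le0.
by rewrite (le_trans (xyS j)) // S0 mulr0.
Qed.

End Calculus.

(** * The Fisher metric as a variance *)

Section Fisher.
Context (R : realType) (n : nat) (Omega : finType) (E : expFamily R n Omega).

Definition fin_variance (p X : Omega -> R) : R :=
  Defs.expectation p (fun x => (X x - Defs.expectation p X) ^+ 2).

Definition linear_statistic (eta : 'rV[R]_n) (x : Omega) : R :=
  \sum_(k < n) eta 0 k * efF E k x.

(** This is exp(psi(theta)) as an explicit sum that can be differentiated term by term; [efpsi] is
    constrained only by the normalization [ef_prob]. *)
Definition partition_fun (theta : 'rV[R]_n) : R :=
  \sum_x expR (efC E x + linear_statistic theta x).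

(** The terms are positive, and Omega is nonempty because the probabilities sum to 1. *)
Lemma partition_fun_gt0 theta : 0 < partition_fun theta.
Proof.
have := ef_prob E theta; rewrite /partition_fun => p1.
rewrite lt_neqAle sumr_ge0 ?andbT => [|x _]; last exact: expR_ge0.
apply/eqP => /esym/eqP; rewrite psumr_eq0 => [|x _]; last exact: expR_ge0.
move=> /allP ex0; move: p1; rewrite big1 => [/eqP|x _].
  by rewrite eq_sym oner_eq0.
by have := ex0 x (mem_index_enum x); rewrite /= gt_eqF ?expR_gt0.
Qed.

Lemma ef_pE theta x :
  ef_p E theta x = expR (efC E x + linear_statistic theta x) / partition_fun theta.
Proof.
have p1 := ef_prob E theta.
rewrite /ef_p expRD -/(linear_statistic theta x); congr (_ * _).
have Z0 := partition_fun_gt0 theta.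
apply: (mulfI (lt0r_neq0 Z0)); rewrite divff ?lt0r_neq0 // -p1 mulr_suml.
by apply: eq_bigr => y _; rewrite -expRD.
Qed.

(** Here ln p = C + <theta, F> - ln Z, and the logarithmic derivative of the partition function Z in
    direction i is the mean of F_i. *)
Lemma derive_ln_ef_p theta i x :
  'D_(delta_mx 0 i) (fun th => ln (ef_p E th x)) theta =
  efF E i x - Defs.expectation (ef_p E theta) (efF E i).
Proof.
rewrite derive_line0.
pose A y : R := efC E y + linear_statistic theta y.
have lin h y : linear_statistic (h *: delta_mx 0 i + theta) y =
    h * efF E i y + linear_statistic theta y.
  rewrite /linear_statistic (eq_bigr (fun k => h * ((k == i)%:R * efF E k y) +
     theta 0 k * efF E k y)) => [|k _]; last by rewrite !mxE eqxx /=; ring.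
  rewrite big_split /= -mulr_sumr; congr (h * _ + _).
  by rewrite (bigD1 i) //= eqxx mul1r big1 ?addr0 // => k /negbTE ->; rewrite mul0r.
pose Z (h : R) : R := \sum_y expR (A y + h * efF E i y).
have ZE h : partition_fun (h *: delta_mx 0 i + theta) = Z h.
  by apply: eq_bigr => y _; rewrite lin /A; congr expR; ring.
have Z0 : Z 0 = partition_fun theta by rewrite -ZE scale0r add0r.
have -> : (fun h : R => ln (ef_p E (h *: delta_mx 0 i + theta) x)) =
    (fun h => (A x + h * efF E i x) - ln (Z h)).
  apply/funext => h; rewrite ef_pE ZE.
  rewrite ln_div ?posrE ?expR_gt0 -?ZE ?partition_fun_gt0 // expRK lin /A.
  by congr (_ - _); ring.
have dA y : is_derive (0 : R) (1 : R) (fun h : R => A y + h * efF E i y) (efF E i y).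
  have [d1 d2] := is_deriveD (is_derive_cst (A y) (0 : R) (1 : R))
    (is_deriveM (is_derive_id (0 : R) (1 : R))
                (is_derive_cst (efF E i y) (0 : R) (1 : R))).
  split; first exact: d1.
  by move: d2; rewrite scaler0 !add0r [_ *: 1]mulr1.
have dZ : is_derive (0 : R) (1 : R) Z (\sum_y expR (A y) * efF E i y).
  apply: is_derive_bigsum => y.
  apply: (is_derive_eq (is_derive1_comp (is_derive_expR _) (dA y))).
  by rewrite mul0r addr0.
have dlnZ : is_derive (0 : R) (1 : R) (fun h => ln (Z h))
    ((Z 0)^-1 * \sum_y expR (A y) * efF E i y).
  by apply: is_derive1_comp; apply: is_derive1_ln; rewrite Z0 partition_fun_gt0.
have [_ ->] := is_deriveB (dA x) dlnZ; congr (_ - _).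
rewrite Z0 mulr_sumr; apply: eq_bigr => y _.
by rewrite ef_pE /A; ring.
Qed.

(** The Fisher matrix is the covariance matrix of the F_i, and the centred linear statistic is the
    combination of the centred F_i with coefficients eta; its square expands into the quadratic
    form. *)
Lemma fisher_quadratic theta eta :
  (eta *m fisher E theta *m eta^T) 0 0 =
  fin_variance (ef_p E theta) (linear_statistic eta).
Proof.
set p := ef_p E theta; pose G i x := efF E i x - Defs.expectation p (efF E i).
have fisherE i j : fisher E theta i j = \sum_x G i x * G j x * p x.
  by rewrite mxE; apply: eq_bigr => x _; rewrite !derive_ln_ef_p.
have GE x : linear_statistic eta x - Defs.expectation p (linear_statistic eta) =
    \sum_i eta 0 i * G i x.
  rewrite /linear_statistic /Defs.expectation.
  under [in X in _ - X]eq_bigr do rewrite mulr_suml.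
  rewrite exchange_big /= -sumrB; apply: eq_bigr => i _.
  rewrite /G /Defs.expectation mulrBr mulr_sumr; congr (_ - _).
  by apply: eq_bigr => y _; rewrite mulrA.
rewrite /fin_variance {1}/Defs.expectation.
under eq_bigr do rewrite GE expr2 mulr_suml mulr_suml.
rewrite [RHS]exchange_big /= mxE.
under [LHS]eq_bigr do rewrite mxE mulr_suml.
rewrite exchange_big /=; apply: eq_bigr => i _.
under [RHS]eq_bigr do rewrite mulr_sumr mulr_suml.
rewrite [RHS]exchange_big /=; apply: eq_bigr => j _.
rewrite fisherE mxE mulr_sumr mulr_suml; apply: eq_bigr => x _.
by ring.
Qed.

(** A vanishing sum of nonnegative terms: X equals its mean wherever p is nonzero. *)
Lemma fin_variance_eq0 (p X : Omega -> R) : (forall x, 0 <= p x) ->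
  fin_variance p X = 0 -> forall x y, p x != 0 -> p y != 0 -> X x = X y.
Proof.
move=> p0 /eqP; rewrite psumr_eq0 => [/allP v0 x y px py|x _]; last first.
  by rewrite mulr_ge0 ?sqr_ge0.
have Xc z : p z != 0 -> X z = Defs.expectation p X.
  move=> pz; have := v0 z (mem_index_enum z).
  by rewrite /= mulf_eq0 (negbTE pz) orbF sqrf_eq0 subr_eq0 => /eqP.
by rewrite !Xc.
Qed.

Lemma fin_variance_dirac (x : Omega) (X : Omega -> R) :
  fin_variance (dirac_fun R x) X = 0.
Proof.
have Ed Z : Defs.expectation (dirac_fun R x) Z = Z x.
  rewrite /Defs.expectation (bigD1 x) //= /dirac_fun eqxx mulr1 big1 ?addr0 //.
  by move=> y; rewrite eq_sym => /negbTE ->; rewrite mulr0.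
by rewrite /fin_variance !Ed subrr expr0n.
Qed.

Lemma continuous_ptws_eval (T : topologicalType) (K : T -> {ptws Omega -> R})
    (t : T) (x : Omega) : {for t, continuous K} ->
  {for t, continuous (fun s => K s x)}.
Proof.
move=> Kc; apply: (@continuous_comp _ _ _ K (fun f => f x)) => //.
exact: (@proj_continuous _ (fun=> R) x).
Qed.

Lemma continuous_fin_variance (T : topologicalType) (K : T -> {ptws Omega -> R})
    (t : T) (X : Omega -> R) : {for t, continuous K} ->
  {for t, continuous (fun s => fin_variance (K s) X)}.
Proof.
move=> Kc.
have Kx x : {for t, continuous (fun s => K s x)} by exact: continuous_ptws_eval.
have Ec : {for t, continuous (fun s => Defs.expectation (K s) X)}.
  apply: continuous_bigsum => x; apply: continuousM; first exact: cst_continuous.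
  exact: Kx.
apply: continuous_bigsum => x; apply: continuousM; last exact: Kx.
have Dc : {for t, continuous (fun s => X x - Defs.expectation (K s) X)}.
  by apply: continuousB; [exact: cst_continuous | exact: Ec].
exact: (continuousM Dc Dc).
Qed.

End Fisher.

(** * Density of the free points of an effective torus action *)

(** Continuity is asked at x alone, since functions read in a chart are controlled only on its
    domain. *)
Lemma continuous_eq_closure (T U : topologicalType) (f g : T -> U) (D : set T)
    (x : T) :
  hausdorff_space U -> {for x, continuous f} -> {for x, continuous g} ->
  closure D x -> (forall y, D y -> f y = g y) -> f x = g x.
Proof.
move=> hU fc gc Dx fg; apply: hU => A B fA gB.
have [|y [Dy [Ay By]]] := Dx (f @^-1` A `&` g @^-1` B).
  by apply: filterI; [exact: fc | exact: gc].
by exists (f y); split=> //; rewrite fg.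
Qed.

Lemma continuous_pair (T U V : topologicalType) (f : T -> U) (g : T -> V)
    (x : T) : {for x, continuous f} -> {for x, continuous g} ->
  {for x, continuous (fun y => (f y, g y))}.
Proof. by move=> fc gc; apply: cvg_pair; [exact: fc | exact: gc]. Qed.

(** * The torus as a quotient of R^n *)

Section Torus.
Context (R : realType) (n : nat).
Local Notation tpi := (@torus_pi R n).

Lemma torus_piB s t : tpi (s - t) = tpi s - tpi t.
Proof. by rewrite /torus_pi; rewrite raddfB. Qed.

Lemma torus_piD s t : tpi (s + t) = tpi s + tpi t.
Proof. by rewrite /torus_pi; rewrite raddfD. Qed.

Lemma torus_pi0 : tpi 0 = 0.
Proof. by rewrite /torus_pi; rewrite raddf0. Qed.

Lemma torus_pi_eq0 t : tpi t = 0 <-> int_vector t.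
Proof.
rewrite -torus_pi0.
have := Quotient.idealrBE (Zn R n) t 0; rewrite subr0 => E.
by split=> [t0|it]; [rewrite -[int_vector t]/(t \in Zn R n) E; apply/eqP
  | apply/eqP; rewrite -E].
Qed.

Lemma torus_reprK (a : torus R n) : tpi (torus_repr a) = a.
Proof. by rewrite /torus_pi /torus_repr reprK. Qed.

Lemma torus_piMn t m : tpi (t *+ m) = tpi t *+ m.
Proof. by rewrite /torus_pi; rewrite raddfMn. Qed.

End Torus.

(** * Charts of a complex manifold *)

Section Charts.
Context (R : realType) (n : nat) (N : kahlerData R n).
Context (Nmfd : is_complex_manifold N).
Implicit Types (i : kidx N) (p q : N).

Lemma kmapK i q : kdom i q -> kinv i (kmap i q) = q.
Proof.
by move=> iq; have [_ _ _ /(_ i)[iK _ _] _] := Nmfd; rewrite iK // inE.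
Qed.

Lemma kdom_nbhs i q : kdom i q -> nbhs q (kdom i).
Proof.
move=> iq; have [_ _ /(_ i)[io _] _ _] := Nmfd.
by apply: open_nbhs_nbhs; split.
Qed.

Lemma kimg_kmap i q : kdom i q -> kimg i (kmap i q).
Proof. by move=> iq; exists q. Qed.

Lemma kimg_nbhs i x : kimg i x -> nbhs x (kimg i).
Proof.
move=> ix; have [_ _ /(_ i)[_ io] _ _] := Nmfd.
by apply: open_nbhs_nbhs; split.
Qed.

Lemma kimg_kdom i x : kimg i x -> kdom i (kinv i x).
Proof. by move=> [q iq <-]; rewrite kmapK. Qed.

Lemma kinvK i x : kimg i x -> kmap i (kinv i x) = x.
Proof. by move=> [q iq <-]; rewrite kmapK. Qed.

Lemma kmap_continuous i q : kdom i q -> {for q, continuous (kmap i)}.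
Proof. by move=> iq; have [_ _ _ /(_ i)[_ mc _] _] := Nmfd; exact: mc. Qed.

Lemma kinv_continuous i x : kimg i x -> {for x, continuous (kinv i)}.
Proof. by move=> ix; have [_ _ _ /(_ i)[_ _ vc] _] := Nmfd; exact: vc. Qed.

Lemma kinv_nbhs i q (A : set N) : kdom i q -> nbhs q A ->
  nbhs (kmap i q) [set x | kimg i x /\ A (kinv i x)].
Proof.
move=> iq qA; apply: filterI; first exact/kimg_nbhs/kimg_kmap.
by apply: (kinv_continuous (kimg_kmap iq)); rewrite kmapK.
Qed.

Lemma manifold_hausdorff : hausdorff_space N.
Proof. by have [[]] := Nmfd. Qed.

Lemma manifold_chart p : exists i, kdom i p.
Proof. by have [_ /(_ p)] := Nmfd. Qed.

End Charts.

(** * Fixed points of torsion elements and free points *)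

Section FreePoints.
Context (R : realType) (n : nat) (N : kahlerData R n).
Context (Phi : torus R n -> N -> N).
Context (Nmfd : is_complex_manifold N).
Context (Phi_action : smooth_action Phi).
Context (Phi_smooth : forall a, smooth_map_on setT (Phi a)).
Implicit Types (i : kidx N) (p q : N) (a b : torus R n).

Lemma action_continuous a : continuous (Phi a).
Proof. by move=> p; have [+ _] := Phi_smooth a; apply. Qed.

Lemma action_mulrn a k p : Phi a p = p -> Phi (a *+ k) p = p.
Proof.
have [act0 actD _ _] := Phi_action.
by move=> ap; elim: k => [|k IH]; rewrite ?mulr0n ?act0 // mulrS actD IH.
Qed.

Lemma fixed_points_closed a : closed [set p | Phi a p = p].
Proof.
move=> p pa; apply: (continuous_eq_closure (manifold_hausdorff Nmfd) _ _ pa) => //.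
exact: action_continuous.
Qed.

(* If p is a limit of interior fixed points of [Phi a], the powers of [Phi a]
   have identity derivative at p, hence so has the average of a chart over
   them. This average is locally injective and [Phi a]-invariant, so [Phi a]
   is the identity near p. *)
Lemma interior_fixed_points_closed a m : (0 < m)%N -> a *+ m = 0 ->
  closed (interior [set p | Phi a p = p]).
Proof.
have [act0 actD _ _] := Phi_action.
move=> m0 am0; set S := interior _ => p pS.
have Sfix q : S q -> Phi a q = q by exact: interior_subset.
have So : open S by exact: open_interior.
have pa : Phi a p = p.
  by apply: fixed_points_closed; apply: closure_subset pS => q /Sfix.
have [i ip] := manifold_chart Nmfd p.
set x0 := kmap i p.
pose f k := local_rep (Phi (a *+ k)) i i.
have fU k : smooth_on (kmap i @` (kdom i `&` setT `&` Phi (a *+ k) @^-1` kdom i)) (f k).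
  by have [_] := Phi_smooth (a *+ k); apply.
have nearU k q : kdom i q -> Phi (a *+ k) q = q ->
    nbhs (kmap i q) (kmap i @` (kdom i `&` setT `&` Phi (a *+ k) @^-1` kdom i)).
  move=> iq aq.
  have : nbhs q (Phi (a *+ k) @^-1` kdom i).
    by apply: action_continuous; rewrite aq; exact: kdom_nbhs.
  move=> /(kinv_nbhs Nmfd iq); apply: filterS => x [ix ax].
  by exists (kinv i x); [split; [split=> //; exact: kimg_kdom|] | exact: kinvK].
have fd k v : \forall x \near x0, is_derive x v (f k) ('D_v (f k) x).
  have := nearU k p ip (action_mulrn k pa).
  apply: (@filterS _ _ (nbhs_filter x0)) => x Ux; apply: derivableP.
  by have [_ + _] := fU k 1%N; apply.
have fc k v : {for x0, continuous ('D_v (f k))}.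
  have [_ _ /(_ v)] := fU k 1%N; apply.
  exact: nbhs_singleton (nearU k p ip (action_mulrn k pa)).
(* On the coordinates of S the map [f k] is the identity; these points accumulate at [x0], where the
   derivative is continuous. *)
have f1 k v : 'D_v (f k) x0 = v.
  apply: (@continuous_eq_closure 'rV[R]_(n + n) 'rV[R]_(n + n) ('D_v (f k)) (cst v)
    (kmap i @` (S `&` kdom i)) x0) => //.
  - exact: cst_continuous.
  - move=> B x0B.
    have [|q [Sq [iq Bq]]] := pS (kdom i `&` kmap i @^-1` B).
      by apply: filterI; [exact: kdom_nbhs | exact: kmap_continuous].
    by exists (kmap i q); split=> //; exists q.
  - move=> _ [q [Sq iq] <-].
    rewrite -[RHS](@derive_id R _ (kmap i q) v); apply: near_eq_derive.
    have : nbhs q S by exact: open_nbhs_nbhs.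
    move=> /(kinv_nbhs Nmfd iq); apply: filterS => x [ix /Sfix xS].
    by rewrite /f /local_rep action_mulrn // kinvK.
pose phi x := (m%:R : R)^-1 *: \sum_(k < m) f k x.
have mR : (m%:R : R) != 0 by rewrite pnatr_eq0 -lt0n.
have inj : \forall z \near (x0, x0), phi z.1 = phi z.2 -> z.1 = z.2.
  apply: (@derive_id_injective R _ phi
    (fun l x => m%:R^-1 *: \sum_(k < m) 'D_(delta_mx 0 l) (f k) x)) => l.
  - have := @filter_forall _ _ _ _ (nbhs_filter x0)
      (fun k : 'I_m => fd k (delta_mx 0 l)).
    apply: (@filterS _ _ (nbhs_filter x0)) => x fdx.
    have [d1 d2] := is_deriveZ m%:R^-1 (is_derive_bigsum (index_enum 'I_m) fdx).
    by split.
  - apply: continuousZl_tmp; apply: continuous_bigsum => k; exact: fc.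
  - under eq_bigr do rewrite f1.
    by rewrite sumr_const card_ord -[X in _ *: X = _]scaler_nat scalerA mulVf // scale1r.
have a_near : nbhs p [set q | kdom i q /\ kdom i (Phi a q)].
  apply: filterI; first exact: kdom_nbhs.
  by apply: action_continuous; rewrite pa; exact: kdom_nbhs.
have pair_c : {for p, continuous (fun q => (kmap i (Phi a q), kmap i q))}.
  apply: continuous_pair; last exact: kmap_continuous.
  apply: (@continuous_comp _ _ _ (Phi a)); first exact: action_continuous.
  by rewrite pa; exact: kmap_continuous.
have {}inj : nbhs p [set q | phi (kmap i (Phi a q)) = phi (kmap i q) ->
    kmap i (Phi a q) = kmap i q].
  have inj' : nbhs (kmap i (Phi a p), kmap i p)
      [set z | phi z.1 = phi z.2 -> z.1 = z.2] by rewrite pa.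
  exact: (pair_c _ inj').
apply: filterS (filterI a_near inj) => q [[iq iaq]] eq_phi.
rewrite /= -[LHS](kmapK Nmfd iaq) eq_phi ?kmapK //.
congr (_ *: _); rewrite /f /local_rep !kmapK //.
under eq_bigr do rewrite -actD -mulrSr.
(* The left sum runs over the multiples 1, ..., m of a and the right one over 0, ..., m - 1; they
   agree since a *+ m = 0. *)
case: m m0 am0 {phi mR inj eq_phi} => // m _ am0.
rewrite big_ord_recr big_ord_recl /= am0 mulr0n addrC; by [].
Qed.

(** The interior is both open and closed, so if nonempty it is all of N by connectedness, and
    effectiveness forces a = 0. *)
Lemma torsion_fixed_points_interior a m : connected [set: N] ->
  (forall b, (forall p, Phi b p = p) -> b = 0) ->
  (0 < m)%N -> a *+ m = 0 -> a <> 0 -> interior [set p | Phi a p = p] = set0.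
Proof.
move=> Nconn eff m0 am0 an0; apply: contrapT => S0.
apply: an0; apply: eff => p; apply: (@interior_subset _ [set p | Phi a p = p]).
suff -> : interior [set p | Phi a p = p] = setT by [].
apply: Nconn.
- by apply/set0P/eqP.
- by exists (interior [set p | Phi a p = p]); rewrite ?setTI //; exact: open_interior.
- exists (interior [set p | Phi a p = p]); rewrite ?setTI //.
  exact: interior_fixed_points_closed am0.
Qed.

(** The preimage in R^n of the stabilizer of q is a closed subgroup containing the integer vectors,
    so [closed_subgroup_torsion] applies to it. *)
Lemma stabilizer_torsion_free q :
  (forall t (m : nat), (0 < m)%N -> int_vector (t *+ m) ->
     Phi (torus_pi t) q = q -> int_vector t) ->
  free_points Phi q.
Proof.
have [act0 actD actc _] := Phi_action.
move=> tor a; rewrite -(torus_reprK a) => aq; apply/torus_pi_eq0.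
pose H := [set t : 'rV[R]_n | Phi (torus_pi t) q = q].
have HB s t : H s -> H t -> H (s - t).
  by move=> Hs Ht; rewrite /H /= torus_piB -{1}Ht -actD subrK.
apply: (@closed_subgroup_torsion R n H) => //.
- move=> t tH.
  apply: (@continuous_eq_closure 'rV[R]_n N (fun t => Phi (torus_pi t) q)
    (cst q) _ _ (manifold_hausdorff Nmfd) _ _ tH).
  + apply: (@continuous_comp _ _ _ (fun t => (t, q))
      (fun tp : 'rV[R]_n * N => Phi (torus_pi tp.1) tp.2)); last exact: actc.
    apply: continuous_pair; first exact: cvg_id.
    exact: cst_continuous.
  + exact: cst_continuous.
  + by [].
- by move=> z /torus_pi_eq0 z0; rewrite /H /= z0 act0.
- by move=> h m Hh m0 hm; apply: (tor h m).
Qed.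

Lemma free_points_dense : connected [set: N] ->
  (forall b, (forall p, Phi b p = p) -> b = 0) -> dense (free_points Phi).
Proof.
move=> Nconn eff O [q0 Oq0] Oo.
have [i iq0] := manifold_chart Nmfd q0.
(* Baire's theorem needs a complete space, so the argument moves to the image of the open set in a
   chart. *)
pose V := kmap i @` (O `&` kdom i).
have Vimg x : V x -> kimg i x by move=> [q [_ iq] <-]; exists q.
have VO x : V x -> O (kinv i x) by move=> [q [Oq iq] <-]; rewrite kmapK.
have Vo : open V.
  rewrite openE => _ [q [Oq iq] <-].
  have : nbhs q O by exact: open_nbhs_nbhs.
  move=> /(kinv_nbhs Nmfd iq); apply: filterS => x [ix Ox].
  by exists (kinv i x); [split=> //; exact: kimg_kdom | exact: kinvK].
(* Torsion elements are the classes of z / (m + 1) with z integral, and the pairs (z, m) are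
   countable. A number k that encodes no pair gives an empty [F k]. *)
pose tor (k : nat) : option ('rV[int]_n * nat) := unpickle k.
pose el (zm : 'rV[int]_n * nat) : torus R n :=
  torus_pi (\row_j ((zm.1 0 j)%:~R / zm.2.+1%:R)).
pose F (k : nat) : set 'rV[R]_(n + n) := [set x |
  exists2 zm, tor k = Some zm & el zm <> 0 /\ Phi (el zm) (kinv i x) = kinv i x].
have el_tor zm : el zm *+ zm.2.+1 = 0.
  rewrite -torus_piMn; apply/torus_pi_eq0/forallP => j.
  by rewrite mulmxnE mxE -[_ / _ *+ _]mulr_natr divfK ?pnatr_eq0 // intr_int.
have [||k x Vx Vcl|k W Wo WVF|x Vx Fx] := @baire_open R _ V F.
- exact: Vo.
- by exists (kmap i q0); exists q0.
- have [y [[_ [zm kzm [zm0 _]]] _]] := Vcl setT filterT.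
  exists zm => //; split=> //.
  apply: (@continuous_eq_closure 'rV[R]_(n + n) N
    (fun y => Phi (el zm) (kinv i y)) (kinv i) _ _
    (manifold_hausdorff Nmfd) _ _ Vcl).
  + apply: (@continuous_comp _ _ _ (kinv i) (Phi (el zm))).
      exact/(kinv_continuous Nmfd)/Vimg.
    exact: action_continuous.
  + exact/(kinv_continuous Nmfd)/Vimg.
  + by move=> z [_ [zm' + [_]]]; rewrite kzm => -[<-].
- apply/seteqP; split=> // x Wx.
  have [Vx [zm kzm [zm0 _]]] := WVF x Wx.
  have := torsion_fixed_points_interior Nconn eff _ (el_tor zm) zm0.
  move=> /(_ isT) I0; suff : set0 (kinv i x) by [].
  rewrite -I0 /interior /=.
  have ix := Vimg x Vx.
  have : nbhs (kinv i x) (kdom i `&` kmap i @^-1` W).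
    apply: filterI; first exact/(kdom_nbhs Nmfd)/kimg_kdom.
    apply: (kmap_continuous Nmfd (kimg_kdom Nmfd ix)); rewrite kinvK //.
    exact: open_nbhs_nbhs.
  apply: filterS => q [iq Wq].
  have [_ [zm' + [_]]] := WVF _ Wq; rewrite kzm => -[<-].
  by rewrite kmapK.
exists (kinv i x); split; first exact: VO.
apply: stabilizer_torsion_free => t m m0 tm tx.
(* Since t *+ m is integral, t = z / m with z its vector of floors; the code stores [m.-1] because
   [el] divides by the successor. *)
apply: contrapT => tN; apply: (Fx (pickle ((\row_j Num.floor (t 0 j *+ m)) : 'rV[int]_n, m.-1))).
eexists; first by rewrite /tor pickleK.
suff -> : el (\row_j Num.floor (t 0 j *+ m), m.-1) = torus_pi t.
  by split=> // /torus_pi_eq0.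
rewrite /el; congr torus_pi; apply/rowP => j; rewrite !mxE /= prednK //.
have := forallP tm j; rewrite mulmxnE => /floorK ->.
by rewrite -[_ *+ m]mulr_natr mulfK // pnatr_eq0 -lt0n.
Qed.

End FreePoints.

(** * Fundamental vector fields and the torification *)

Section Frames.
Context (R : realType) (n : nat) (Y : 'I_n -> 'rV[R]_n -> 'rV[R]_n).
Context (Yframe : parallel_frame Y).

(** The components of a parallel field have zero derivative, so they do not vary along the segment
    from 0 to theta. *)
Lemma parallel_frame_cst i theta : Y i theta = Y i 0.
Proof.
have [/(_ i)[Ys Y0] _] := Yframe.
rewrite -[in LHS](add0r theta) -[X in 0 + X]scale1r.
apply: derive0_eq => t _; split; last exact: Y0.
by have [_ + _] := Ys 1%N; apply.
Qed.

Definition frame_matrix : 'M[R]_n := \matrix_i Y i 0.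

Lemma frame_matrix_unit : frame_matrix \in unitmx.
Proof. by have [_] := Yframe; apply. Qed.

Lemma frame_combination (t : 'rV[R]_n) theta :
  \sum_(i < n) t 0 i *: Y i theta = t *m frame_matrix.
Proof.
rewrite mulmx_sum_row; apply: eq_bigr => i _.
by rewrite rowK parallel_frame_cst.
Qed.

(** Upstairs, orbits of one-parameter subgroups are straight lines in the fibre, with a velocity
    independent of the point. *)
Lemma translate_line (t : R) (xi : 'rV[R]_n) (u : 'rV[R]_(n + n)) :
  translate Y (t *: xi) u = t *: row_mx 0 (xi *m frame_matrix) + u.
Proof.
rewrite /translate frame_combination -scalemxAl -[in RHS](hsubmxK u).
by rewrite scale_row_mx add_row_mx scaler0 add0r addrC.
Qed.

(** In frame coordinates the lattice is Z^n. The set U bounds the fibre coordinates relative to u by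
    1/2, so two of its points in one orbit differ by an integer vector with entries of absolute
    value below 1, hence by 0. *)
Lemma qL_local_injective (u : 'rV[R]_(n + n)) :
  exists2 U : set 'rV[R]_(n + n), open U /\ set_inj U (qL Y) & U u.
Proof.
pose h j (w : 'rV[R]_(n + n)) : R :=
  (rsubmx (w - u) *m invmx frame_matrix) 0 j.
have hc j : continuous (h j).
  move=> w; rewrite /continuous_at /h.
  under eq_fun do rewrite mxE.
  rewrite mxE; apply: (@continuous_bigsum R _ _ _ R (fun k (w : 'rV[R]_(n + n)) =>
    rsubmx (w - u) 0 k * invmx frame_matrix k j)) => k.
  apply: continuousM; last exact: cst_continuous.
  rewrite /prop_for; under eq_fun do rewrite !mxE.
  by apply: continuousB; [exact: coord_continuous | exact: cst_continuous].
exists [set w | forall j, `|h j w| < 2^-1]; last first.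
  by move=> j; rewrite /h subrr !mxE big1 ?normr0 ?invr_gt0 // => k _; rewrite !mxE mul0r.
split.
  rewrite openE => w Uw; apply: (filter_forall (nbhs_filter w)) => j.
  have := @near_dist_lt R _ (h j) w (2^-1 - `|h j w|) (hc j w).
  rewrite subr_gt0 => /(_ (Uw j)); apply: (@filterS _ _ (nbhs_filter w)) => z.
  move=> /= zw; rewrite -[h j z](subrK (h j w)).
  by apply: (le_lt_trans (ler_normD _ _)); lra.
move=> w w' /[!inE] Uw Uw' /qL_eqP/asboolP[k kE].
have hk j : h j w' = h j w + (k j)%:~R.
  rewrite /h kE -[\row_i _]scale1r translate_line scale1r.
  have -> : rsubmx (row_mx 0 ((\row_i (k i)%:~R) *m frame_matrix) + w - u) =
     rsubmx (w - u) + (\row_i (k i)%:~R) *m frame_matrix.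
    by rewrite -addrA addrC linearD /= row_mxKr.
  by rewrite mulmxDl mulmxK ?frame_matrix_unit // !mxE.
rewrite kE -[LHS](translate0 Y); congr translate; apply/rowP => j; rewrite !mxE.
have kj : `|(k j)%:~R : R| < 1.
  have -> : (k j)%:~R = h j w' - h j w :> R by rewrite hk; ring.
  by apply: (le_lt_trans (ler_normB _ _)); have := Uw j; have := Uw' j; lra.
move: kj; rewrite -intr_norm ltrz1.
by case: (k j) => [[|m]|m].
Qed.

End Frames.

(** * Fundamental vector fields in charts *)

Section FundamentalField.
Context (R : realType) (n : nat) (N : kahlerData R n).
Context (Phi : torus R n -> N -> N).
Context (Nmfd : is_complex_manifold N).
Context (Phi_action : smooth_action Phi).
Implicit Types (i : kidx N) (p q : N) (xi : 'rV[R]_n).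

Definition action_chart i (tx : 'rV[R]_n * 'rV[R]_(n + n)) : 'rV[R]_(n + n) :=
  kmap i (Phi (torus_pi tx.1) (kinv i tx.2)).

(** By the group law, moving from time t to t + h means acting by h xi on the point reached at time
    t, so the velocity is the fundamental vector there. *)
Lemma orbit_derive xi i p (t : R) :
  kdom i p -> kdom i (Phi (torus_pi (t *: xi)) p) ->
  is_derive t (1 : R) (fun s : R => kmap i (Phi (torus_pi (s *: xi)) p))
    (fundamental_vector Phi xi i (Phi (torus_pi (t *: xi)) p)).
Proof.
have [act0 actD _ acts] := Phi_action => ip itp.
pose a : 'rV[R]_n * 'rV[R]_(n + n) := (0, kmap i p).
pose v : 'rV[R]_n * 'rV[R]_(n + n) := (xi, 0).
have avE (s : R) : a + s *: v = (s *: xi, kmap i p).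
  have -> : a + s *: v = (0 + s *: xi, kmap i p + s *: 0) by [].
  by rewrite add0r scaler0 addr0.
have [_ /(_ (a + t *: v) v) + _] := acts i i 1%N.
rewrite avE /= kmapK // => /(_ (conj (kimg_kmap ip) itp)) d.
have := @is_derive_line R _ _ (action_chart i) a v t.
rewrite avE => /(_ d) [d1 d2].
have E : (fun s : R => action_chart i (a + s *: v)) =
    (fun s : R => kmap i (Phi (torus_pi (s *: xi)) p)).
  by apply/funext => s; rewrite avE /action_chart kmapK.
rewrite E in d1 d2; split=> //.
rewrite /fundamental_vector /derive1 /derive.
set F := (F in lim (F @ _)); set G := (G in _ = lim (G @ _)).
suff -> : F = G by []; apply/funext => h; rewrite /F /G /= [h *: 1]mulr1 addr0.
by rewrite scale0r -actD scalerDl torus_piD torus_pi0 act0.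
Qed.

(** As a partial derivative of the jointly smooth action, the fundamental vector is seen to depend
    continuously on q. *)
Lemma fundamental_vectorE xi i q : kdom i q ->
  fundamental_vector Phi xi i q = 'D_(xi, 0) (action_chart i) (0, kmap i q).
Proof.
move=> iq; rewrite /fundamental_vector derive1E [RHS]derive_line0.
suff -> : (fun t : R => kmap i (Phi (torus_pi (t *: xi)) q)) =
  (fun h : R => action_chart i (h *: (xi, 0) + (0, kmap i q))) by [].
by apply/funext => h; rewrite /action_chart /= scaler0 addr0 add0r kmapK.
Qed.

Lemma action_chart_derive_continuous xi i p : kdom i p ->
  {for p, continuous
     (fun q => 'D_(xi, 0) (action_chart i) (0, kmap i q))}.
Proof.
move=> ip; have [act0 _ _ acts] := Phi_action.
apply: (@continuous_comp _ _ _ (fun q => (0, kmap i q))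
  ('D_(xi, 0) (action_chart i))).
  by apply: continuous_pair; [exact: cst_continuous | exact: kmap_continuous].
have [_ _ /(_ (xi, 0))] := acts i i 1%N; apply.
split=> /=; first exact: kimg_kmap.
by rewrite kmapK // torus_pi0 act0.
Qed.

Lemma metric_continuous i p (w : N -> 'rV[R]_(n + n)) : is_riemannian N ->
  kdom i p -> {for p, continuous w} ->
  {for p, continuous (fun q => metric i (kmap i q) (w q) (w q))}.
Proof.
move=> [kmets _ _ _] ip wc.
have wj j : {for p, continuous (fun q => w q 0 j)}.
  apply: (@continuous_comp _ _ _ w (fun M => M 0 j)) => //.
  exact: coord_continuous.
have mjk j k : {for p, continuous (fun q => kmet i (kmap i q) j k)}.
  apply: (@continuous_comp _ _ _ (fun q => kmet i (kmap i q)) (fun M => M j k)).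
    apply: (@continuous_comp _ _ _ (kmap i) (kmet i)); first exact: kmap_continuous.
    by apply: (kmets i 0%N); exact: kimg_kmap.
  exact: coord_continuous.
rewrite /prop_for /metric; under eq_fun do rewrite mxE.
apply: continuous_bigsum => j; apply: continuousM.
  rewrite /prop_for; under eq_fun do rewrite mxE.
  by apply: continuous_bigsum => k; apply: continuousM.
by rewrite /prop_for; under eq_fun do rewrite mxE; exact: wj.
Qed.

End FundamentalField.

(** * Norms of fundamental vectors on a torification *)

Section Torification.
Context (R : realType) (n : nat) (Omega : finType) (E : expFamily R n Omega).
Context (N : kahlerData R n) (Phi : torus R n -> N -> N).
Context (Y : 'I_n -> 'rV[R]_n -> 'rV[R]_n) (G : EL E Y -> N) (Ginv : N -> EL E Y).
Context (N_kahler : is_kahler N).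
Context (N_connected : connected [set: N]).
Context (Phi_action : smooth_action Phi).
Context (Phi_smooth : forall a, smooth_map_on setT (Phi a)).
Context (Phi_effective : forall a, (forall p, Phi a p = p) -> a = 0).
Context (torif : torification_by Phi G Ginv).
Context (K : N -> {ptws Omega -> R}).
Context (K_continuous : continuous K).
Context (K_free : forall p, free_points Phi p -> K p = piL (Ginv p)).

Let Nmfd : is_complex_manifold N. Proof. by have [] := N_kahler. Qed.

Lemma free_points_lift q : free_points Phi q ->
  exists2 u, q = G (qL Y u : EL E Y) & K q = ef_p E (lsubmx u).
Proof.
have [_ [Gr Gc _ _] _ _ _] := torif => qf.
have [y _ yq] : range G q by rewrite Gr.
exists (EL_repr y); first by rewrite /qL /EL_repr reprK.
by rewrite K_free // -yq Gc.
Qed.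

(** Density in the local form used by [continuous_eq_closure]; A will be the domain of a chart. *)
Lemma free_points_closure p (A : set N) : nbhs p A ->
  closure (free_points Phi `&` A) p.
Proof.
move=> pA B pB.
have [|q [ABq qf]] :=
    free_points_dense Nmfd Phi_action Phi_smooth N_connected Phi_effective
      (O := interior (A `&` B)) _ (open_interior _).
  by exists p; apply: filterI.
have [Aq Bq] := interior_subset ABq.
by exists q.
Qed.

(** Lift q to u. In a chart of the quotient given by a local inverse of [qL], the orbit is the line
    u + h v, so the differential of G maps v to the fundamental vector. G is an isometry, and the
    norm of v is a Fisher quadratic form. *)
Lemma fundamental_norm_free xi i q : free_points Phi q -> kdom i q ->
  metric i (kmap i q) (fundamental_vector Phi xi i q)
                      (fundamental_vector Phi xi i q) =
  fin_variance (K q) (linear_statistic E (xi *m frame_matrix Y)).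
Proof.
move=> qf iq; have [u qu ->] := free_points_lift qf.
have [Yf _ _ Giso Geq] := torif.
have [U Uprop Uu] := qL_local_injective Yf u.
pose c : kidx (EL E Y) := exist _ U Uprop.
have cdom : kdom c (qL Y u : EL E Y) by exists u.
have cmap : kmap c (qL Y u : EL E Y) = u.
  (* Injectivity of [qL] on U forces the preimage chosen by [xget] to be u. *)
  rewrite /kmap /=; case: xgetP => [w -> [Uw wu]|/(_ u) []//].
  by apply: Uprop.2; rewrite ?inE.
pose v : 'rV[R]_(n + n) := row_mx 0 (xi *m frame_matrix Y).
have fvE : fundamental_vector Phi xi i q = 'D_v (local_rep G c i) u.
  rewrite /fundamental_vector derive1E [RHS]derive_line0.
  suff -> : (fun t : R => kmap i (Phi (torus_pi (t *: xi)) q)) =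
    (fun h : R => local_rep G c i (h *: v + u)) by [].
  apply/funext => h; rewrite qu -Geq PhiYE translate_line //.
have := Giso c i (qL Y u : EL E Y) v v cdom; rewrite -qu => /(_ iq).
rewrite cmap -fvE => ->.
rewrite /metric /= /v mul_row_block !mul0mx !mulmx0 !add0r tr_row_mx mul_row_col.
by rewrite mul0mx add0r fisher_quadratic.
Qed.

Lemma fundamental_norm xi i p : kdom i p ->
  metric i (kmap i p) (fundamental_vector Phi xi i p)
                      (fundamental_vector Phi xi i p) =
  fin_variance (K p) (linear_statistic E (xi *m frame_matrix Y)).
Proof.
move=> ip; rewrite fundamental_vectorE //.
pose w q := 'D_(xi, 0) (action_chart Phi i) (0, kmap i q).
apply: (@continuous_eq_closure N R (fun q => metric i (kmap i q) (w q) (w q))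
  (fun q => fin_variance (K q) (linear_statistic E (xi *m frame_matrix Y)))
  _ _ _ _ _ (free_points_closure (kdom_nbhs Nmfd ip))).
- exact: Rhausdorff.
- apply: metric_continuous => //; first by have [] := N_kahler.
  exact: action_chart_derive_continuous.
- exact/continuous_fin_variance/K_continuous.
- by move=> q [qf iq]; rewrite /w -fundamental_vectorE // fundamental_norm_free.
Qed.

(** On free points the action moves only the fibre coordinates, so theta and hence K are unchanged;
    continuity extends this to N. *)
Lemma natural_extension_invariant a p : K (Phi a p) = K p.
Proof.
apply/funext => x.
apply: (@continuous_eq_closure N R (fun q => K (Phi a q) x) (fun q => K q x)
  _ _ _ _ _ (free_points_closure filterT)).
- exact: Rhausdorff.
- apply: (@continuous_comp _ _ _ (Phi a) (fun q => K q x)).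
    exact: action_continuous.
  exact/continuous_ptws_eval/K_continuous.
- exact/continuous_ptws_eval/K_continuous.
- move=> q [qf _]; have [u qu Kq] := free_points_lift qf.
  have [_ [Gr Gc _ _] _ _ Geq] := torif.
  rewrite Kq qu -(torus_reprK a) -Geq PhiYE K_free ?Gc ?piLE.
    by rewrite /translate row_mxKl.
  by rewrite -Gr.
Qed.

Lemma fixed_point_support p x y k : (forall a, Phi a p = p) ->
  (forall z, 0 <= K p z) -> K p x != 0 -> K p y != 0 ->
  efF E k x = efF E k y.
Proof.
move=> fixp K0 Kx Ky; have [i ip] := manifold_chart Nmfd p.
have [Yf _ _ _ _] := torif.
(* This xi has image [delta_mx 0 k] under the frame matrix, so the variance obtained is that of F_k
   alone. *)
have := @fundamental_norm (delta_mx 0 k *m invmx (frame_matrix Y)) i p ip.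
have -> : fundamental_vector Phi (delta_mx 0 k *m invmx (frame_matrix Y)) i p = 0.
  rewrite /fundamental_vector; under eq_fun do rewrite fixp.
  by rewrite derive1_cst.
rewrite mulmxKV ?frame_matrix_unit // /metric mul0mx mul0mx mxE.
move=> /esym /(fin_variance_eq0 K0) /(_ x y Kx Ky).
have lsE z : linear_statistic E (delta_mx 0 k) z = efF E k z.
  rewrite /linear_statistic (bigD1 k) //= mxE !eqxx mul1r big1 ?addr0 // => j jk.
  by rewrite mxE (negbTE jk) andbF mul0r.
by rewrite !lsE.
Qed.

(** The variance under a Dirac function is 0 and the metric is positive definite. *)
Lemma dirac_fundamental_vector x xi i p : kdom i p -> K p = dirac_fun R x ->
  fundamental_vector Phi xi i p = 0.
Proof.
move=> ip Kp; apply/eqP/negPn/negP => fv0.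
have [_ [_ _ /(_ i (kmap i p) _ (kimg_kmap ip) fv0) + _] _ _] := N_kahler.
by rewrite fundamental_norm // Kp fin_variance_dirac ltxx.
Qed.

(** For small times the orbit stays in one chart; K is still the same Dirac function along it, so
    the velocity vanishes and the orbit is constant. *)
Lemma dirac_fixed_point x p : K p = dirac_fun R x -> forall a, Phi a p = p.
Proof.
have [act0 actD actc _] := Phi_action.
move=> Kp a; rewrite -(torus_reprK a); set xi := torus_repr a.
have [i ip] := manifold_chart Nmfd p.
have orbit0 : Phi (torus_pi ((0 : R) *: xi)) p = p.
  by rewrite scale0r torus_pi0 act0.
have orbit_c : continuous (fun t : R => Phi (torus_pi (t *: xi)) p).
  move=> t; apply: (@continuous_comp _ _ _ (fun t : R => (t *: xi, p))
    (fun tp : 'rV[R]_n * N => Phi (torus_pi tp.1) tp.2)); last exact: actc.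
  apply: continuous_pair; last exact: cst_continuous.
  exact: scalel_continuous.
have /nbhs_ballP[r /= r0 rP] :
    nbhs (0 : R) [set t : R | kdom i (Phi (torus_pi (t *: xi)) p)].
  by apply: orbit_c; rewrite orbit0; exact: kdom_nbhs.
have near_fix (t : R) : `|t| < r -> Phi (torus_pi (t *: xi)) p = p.
  move=> tr; have dom (s : R) : `|s| <= `|t| -> kdom i (Phi (torus_pi (s *: xi)) p).
    by move=> st; apply: rP; rewrite /ball /= sub0r normrN (le_lt_trans st).
  rewrite -[LHS](kmapK Nmfd (dom t (lexx _))) -[RHS](kmapK Nmfd ip); congr kinv.
  have := @derive0_eq R R _ (fun s : R => kmap i (Phi (torus_pi (s *: xi)) p)) 0 1 t.
  rewrite [t *: 1]mulr1 add0r orbit0; apply => s st.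
  rewrite [s *: 1]mulr1 add0r.
  have [ds ->] := orbit_derive Nmfd Phi_action ip (dom s st).
  split=> //; apply: (@dirac_fundamental_vector x) => //; first exact: dom.
  by rewrite natural_extension_invariant.
(* Acting by xi / (m + 1) fixes p, and a is the (m + 1)-fold multiple of that element. *)
have [m mr] : exists m : nat, (m.+1%:R : R)^-1 < r.
  exists (Num.bound r^-1); rewrite -[ltRHS]invrK ltf_pV2 ?posrE ?invr_gt0 ?ltr0n //.
  apply: (@lt_trans _ _ (Num.bound r^-1)%:R); last by rewrite ltr_nat.
  by rewrite archi_boundP // invr_ge0 ltW.
have := near_fix (m.+1%:R^-1).
rewrite gtr0_norm ?invr_gt0 ?ltr0n // => /(_ mr) /(action_mulrn Phi_action m.+1).
by rewrite -torus_piMn -[_ *+ _]scaler_nat scalerA divff ?pnatr_eq0 // scale1r.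
Qed.

End Torification.

(** * Fixed points and Dirac functions *)

Theorem proposition7p9 (R : realType) (n : nat) (Omega : finType)
    (E : expFamily R n Omega) (N : kahlerData R n)
    (Phi : torus R n -> N -> N)
    (N_toric : kahler_toric Phi)
    (N_torification : regular_torification E Phi)
    (kappa K : N -> {ptws Omega -> R})
    (kappa_compat : compatible_projection E Phi kappa)
    (K_ext : natural_extension E Phi kappa K)
    (E_sep : separates_points (ef_A E))
    (p : N) :
  (forall a : torus R n, Phi a p = p) <->
  (exists x : Omega, K p = dirac_fun R x).
Proof.
have [Nk [Nconn _] [Phia Phih] eff _] := N_toric.
have Phis a : smooth_map_on setT (Phi a) by have [[]] := Phih a.
have [Y [G [Ginv [torif kapE]]]] := kappa_compat.
have [Kc Kcl Kfree] := K_ext.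
have Kf q : free_points Phi q -> K q = piL (Ginv q).
  by move=> qf; rewrite Kfree // kapE.
split=> [fixp|[x Kp]]; last exact: (dirac_fixed_point Nk Nconn Phia Phis eff torif Kc Kf Kp).
have [[K0 K1] _] := Kcl p.
have [x Kx] : exists x, K p x != 0.
  apply: contrapT => /forallNP K0'; move: K1; rewrite big1 => [/eqP|x _].
    by rewrite eq_sym oner_eq0.
  by apply/eqP/negPn/negP/K0'.
(* A separating X is affine in the F_k, which take equal values at any two points of the support of
   K p. *)
have Ky y : x != y -> K p y = 0.
  move=> xy; apply/eqP/negPn/negP => Ky.
  have [X [c [a XE]]] := E_sep x y (fun e => negP xy (introT eqP e)).
  apply; rewrite !XE; congr (_ + _); apply: eq_bigr => k _; congr (_ * _).
  exact: (fixed_point_support Nk Nconn Phia Phis eff torif Kc Kf k fixp K0 Kx Ky).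
exists x; apply/funext => y; rewrite /dirac_fun.
case: eqP => [<-|/eqP/Ky//].
(* The remaining value is the total mass 1. *)
by move: K1; rewrite (bigD1 x) //= big1 ?addr0 // => z; rewrite eq_sym; exact: Ky.
Qed.
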